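(* For each of the three detailed profiles $$\mathbf p\in\{(1,0,0;1,2,2;3),\ (1,1,0;1,2,1;3),\ (1,1,0;1,2,2;2)\}$$ there is a nonempty Euclidean-open set $\mathcal O_{\mathbf p}\subset\mathbb{R}^{3\times 3}$ such that every matrix in $\mathcal O_{\mathbf p}$ satisfies the following properties: (i) it is full-capacity; (ii) its $9$ Pareto eigenvalues are regular; (iii) every Pareto eigenvalue has a unique producing support; (iv) its intrinsic detailed support profile is $\mathbf p$. The three sets $\mathcal O_{\mathbf p}$ are pairwise disjoint.
   Context: Vector inequalities are componentwise ($u>0$ means all components are positive). For $A\in\mathbb{R}^{n\times n}$, a real number $\lambda$ is a Pareto eigenvalue of $A$ if there is $x\in\mathbb{R}^n\setminus\{0\}$ with $x\ge 0$, $Ax-\lambda x\ge 0$ and $\langle x,Ax-\lambda x\rangle=0$. The set of Pareto eigenvalues is $\Pi(A)$. The Pareto capacity of order $n$ is $c_n:=\max_{A\in\mathbb{R}^{n\times n}}|\Pi(A)|$, and $A\in\mathbb{R}^{n\times n}$ is full-capacity if $|\Pi(A)|=c_n$ (for $n=3$, $c_3=9$). A support is a nonempty subset $J\subseteq\{1,\dots,n\}$, with complement $J^{\mathrm c}$; $A_J$ is the principal submatrix indexed by $J$ and $A_{J^{\mathrm c},J}$ is the submatrix with rows in $J^{\mathrm c}$ and columns in $J$. The support $J$ produces $\lambda\in\mathbb{R}$ if there is $u\in\mathbb{R}^{|J|}$ with $A_Ju=\lambda u$, $u>0$, $A_{J^{\mathrm c},J}u\ge 0$. The set of values produced by $J$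 is $\Pi_J(A)$; one has $\Pi(A)=\bigcup_J\Pi_J(A)$. A value $\lambda\in\Pi_J(A)$ is regularly produced by $J$ if it is an algebraically simple eigenvalue of $A_J$ and every component of $A_{J^{\mathrm c},J}u$ is positive, where $u$ is the vector above (the second condition is empty if $J=\{1,\dots,n\}$). A Pareto eigenvalue is regular if it is regularly produced by at least one support. An assigned support map for $A$ is a map $\tau$ from $\Pi(A)$ to the set of supports such that $\lambda\in\Pi_{\tau(\lambda)}(A)$ for every $\lambda\in\Pi(A)$. Put $m_J:=|\{\lambda\in\Pi(A):\tau(\lambda)=J\}|$. For $n=3$ the detailed assigned profile is $(m_1,m_2,m_3;m_{12},m_{13},m_{23};m_{123})$, where $m_i=m_{\{i\}}$, $m_{ij}=m_{\{i,j\}}$, $m_{123}=m_{\{1,2,3\}}$. When every Pareto eigenvalue of $A$ has a unique producing support, there is exactly one assigned support map, and its detailed assigned profile is called the intrinsic detailed support profile of $A$. *)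

(* Defs.v *)
(* MathComp and MathComp-Analysis; the real numbers are an arbitrary
   [R : realType]. *)
From HB Require Import structures.
From mathcomp Require Import all_boot all_order all_algebra.
From mathcomp Require Import boolp classical_sets functions cardinality reals.
From mathcomp Require Import topology normedtype.

Set Implicit Arguments.
Unset Strict Implicit.
Unset Printing Implicit Defensive.

Import Order.TTheory GRing.Theory Num.Theory.
Import numFieldNormedType.Exports.

Local Open Scope card_scope.
Local Open Scope classical_set_scope.
Local Open Scope ring_scope.

Section Pareto.
Context {R : realType}.

Definition cv_ge0 n (u : 'cV[R]_n) := forall i, 0 <= u i 0.
Definition cv_gt0 n (u : 'cV[R]_n) := forall i, 0 < u i 0.
Definition dotcv n (x y : 'cV[R]_n) : R := \sum_(i < n) x i 0 * y i 0.

Definition pareto_eigenvalue n (A : 'M[R]_n) (lam : R) : Prop :=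
  exists x : 'cV[R]_n,
    [/\ x <> 0, cv_ge0 x, cv_ge0 (A *m x - lam *: x)
      & dotcv x (A *m x - lam *: x) = 0].

Definition pareto_spectrum n (A : 'M[R]_n) : set R :=
  [set lam | pareto_eigenvalue A lam].

(* [S] has exactly [k] elements; in particular [S] is finite. *)
Definition has_card (T : Type) (S : set T) (k : nat) : Prop := S #= `I_k.

Definition principal_submx n (A : 'M[R]_n) (J : {set 'I_n}) : 'M[R]_#|J| :=
  mxsub (@enum_val _ (mem J)) (@enum_val _ (mem J)) A.

Definition offsupport_submx n (A : 'M[R]_n) (J : {set 'I_n}) :
    'M[R]_(#|~: J|, #|J|) :=
  mxsub (@enum_val _ (mem (~: J))) (@enum_val _ (mem J)) A.

Definition produces_with n (A : 'M[R]_n) (J : {set 'I_n}) (lam : R)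
    (u : 'cV[R]_#|J|) : Prop :=
  [/\ principal_submx A J *m u = lam *: u, cv_gt0 u
    & cv_ge0 (offsupport_submx A J *m u)].

#[global] Arguments produces_with [n] A J lam u.

Definition produced_values n (A : 'M[R]_n) (J : {set 'I_n}) : set R :=
  [set lam | J <> finset.set0 /\ exists u, produces_with A J lam u].

Definition simple_eigenvalue n (A : 'M[R]_n) (lam : R) : Prop :=
  mup lam (char_poly A) = 1%N.

Definition regularly_produced n (A : 'M[R]_n) (J : {set 'I_n}) (lam : R) :=
  [/\ J <> finset.set0, simple_eigenvalue (principal_submx A J) lam
    & exists2 u, produces_with A J lam u & cv_gt0 (offsupport_submx A J *m u)].

Definition regular_pareto_eigenvalue n (A : 'M[R]_n) (lam : R) : Prop :=
  pareto_eigenvalue A lam /\ exists J, regularly_produced A J lam.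

(* Only the values of [tau] on the Pareto spectrum of [A] are meaningful. *)
Definition assigned_support_map n (A : 'M[R]_n) (tau : R -> {set 'I_n}) :=
  forall lam, pareto_spectrum A lam -> produced_values A (tau lam) lam.

Definition assigned_values n (A : 'M[R]_n) (tau : R -> {set 'I_n})
    (J : {set 'I_n}) : set R :=
  [set lam | pareto_spectrum A lam /\ tau lam = J].

Definition unique_producing_supports n (A : 'M[R]_n) : Prop :=
  forall lam, pareto_spectrum A lam -> exists! J, produced_values A J lam.

End Pareto.

Definition is_pareto_capacity (R : realType) (n c : nat) : Prop :=
  (exists A : 'M[R]_n, has_card (pareto_spectrum A) c) /\
  (forall A : 'M[R]_n, pareto_spectrum A #<= `I_c).

Definition full_capacity (R : realType) (n : nat) (A : 'M[R]_n) : Prop :=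
  exists2 c, is_pareto_capacity R n c & has_card (pareto_spectrum A) c.

(* ((m_1, m_2, m_3), (m_12, m_13, m_23), m_123) *)
Definition profile : Type := (nat * nat * nat) * (nat * nat * nat) * nat.

(* The indices 1, 2, 3 are the elements 0, 1, 2 of 'I_3. *)
Definition idx1 : 'I_3 := @Ordinal 3 0 isT.
Definition idx2 : 'I_3 := @Ordinal 3 1 isT.
Definition idx3 : 'I_3 := @Ordinal 3 2 isT.

Definition has_detailed_profile (R : realType) (A : 'M[R]_3)
    (tau : R -> {set 'I_3}) (p : profile) : Prop :=
  let: ((m1, m2, m3), (m12, m13, m23), m123) := p in
  let m J k := has_card (assigned_values A tau J) k in
  [/\ [/\ m [set idx1]%SET m1, m [set idx2]%SET m2 & m [set idx3]%SET m3],
      [/\ m [set idx1; idx2]%SET m12, m [set idx1; idx3]%SET m13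
        & m [set idx2; idx3]%SET m23]
    & m [set: 'I_3]%SET m123].

Definition has_intrinsic_profile (R : realType) (A : 'M[R]_3) (p : profile) :=
  unique_producing_supports A /\
  exists tau,
    [/\ assigned_support_map A tau,
        forall tau', assigned_support_map A tau' ->
          forall lam, pareto_spectrum A lam -> tau' lam = tau lam
      & has_detailed_profile A tau p].

Definition listed_profile (p : profile) : Prop :=
  [\/ p = ((1, 0, 0), (1, 2, 2), 3)%N,
      p = ((1, 1, 0), (1, 2, 1), 3)%N
    | p = ((1, 1, 0), (1, 2, 2), 2)%N].

(* Main.v *)
Require Import Defs.
From HB Require Import structures.
From mathcomp Require Import all_boot all_order all_algebra.
From mathcomp Require Import ring lra.
From mathcomp Require Import boolp classical_sets functions cardinality reals.
From mathcomp Require Import topology normedtype.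
Set Implicit Arguments.
Unset Strict Implicit.
Unset Printing Implicit Defensive.
Import Order.TTheory GRing.Theory Num.Theory.
Import numFieldNormedType.Exports.
Local Open Scope classical_set_scope.
Local Open Scope ring_scope.

(* A support of size s produces at most s values, which gives 3 + 6 + 3 = 12 for
   n = 3; a singleton {i} produces at most one value, and none unless column i is
   nonnegative off the diagonal, while {i,j} produces two only if a_ij and a_ji
   are not both nonnegative.  Counting by the number of such columns leaves one
   case with total 10: columns i and j are nonnegative, {i,k} and {j,k} both
   produce two values and {1,2,3} three.  It is excluded because the inequalities
   of {i,k} and {j,k} force the characteristic polynomial to be nonnegative at a
   point lying below all three eigenvalues.  Hence c_3 = 9 once nine is attained.

   For each profile an explicit integer matrix has the eigenvalues needed in
   unit windows (m, m + 1), certified by sign changes of the polynomials of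
   degree 2 and 3; an eigenvector with entries affine in the eigenvalue has its
   signs certified at the ends of the window.  These finitely many strict
   inequalities define the open set. *)

(** * Production by a support, for any order *)

Section Supports.
Context {R : realType} {n : nat}.
Implicit Types (A : 'M[R]_n) (J : {set 'I_n}) (lam : R) (x : 'I_n -> R).

(** Vectors on a support are functions on all indices of which only the values on [J] count, so that
    later arguments use membership in [J] instead of the enumeration of ['I_#|J|]. *)
Definition eigen_on A J lam x : Prop :=
  forall i, i \in J -> \sum_(j in J) A i j * x j = lam * x i.

Definition eigenvalue_on A J lam : Prop :=
  exists x, (exists2 i, i \in J & x i != 0) /\ eigen_on A J lam x.

Definition positive_on J x : Prop := forall i, i \in J -> 0 < x i.

Let restrict J x : 'cV[R]_#|J| := \col_i x (enum_val i).

Lemma mxsub_enum_val (B J : {set 'I_n}) A x i :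
  (mxsub (@enum_val _ (mem B)) (@enum_val _ (mem J)) A *m restrict J x) i 0 =
  \sum_(j in J) A (enum_val i) j * x j.
Proof.
rewrite mxE (big_enum_val (fun j => A (enum_val i) j * x j)) /=.
by apply: eq_bigr => j _; rewrite !mxE.
Qed.

Lemma restrictP J (u : 'cV[R]_#|J|) : J <> finset.set0 ->
  exists x, u = restrict J x.
Proof.
move=> /eqP /set0Pn[i0 Ji0]; exists (fun i => u (enum_rank_in Ji0 i) 0).
by apply/colP => i; rewrite mxE enum_valK_in.
Qed.

Lemma forall_enum_val (J : {set 'I_n}) (P : 'I_n -> Prop) :
  (forall i : 'I_#|J|, P (enum_val i)) <-> (forall i, i \in J -> P i).
Proof.
split=> [h i Ji|h i]; last exact/h/enum_valP.
by rewrite -(enum_rankK_in Ji Ji).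
Qed.

Lemma eigen_restrictP A J lam x :
  principal_submx A J *m restrict J x = lam *: restrict J x <->
  eigen_on A J lam x.
Proof.
rewrite /eigen_on -forall_enum_val; split=> h => [i|].
  by move/colP/(_ i): h; rewrite mxsub_enum_val !mxE.
by apply/colP => i; rewrite mxsub_enum_val h !mxE.
Qed.

Lemma producesP A J lam x : produces_with A J lam (restrict J x) <->
  [/\ eigen_on A J lam x, positive_on J x
    & forall i, i \notin J -> 0 <= \sum_(j in J) A i j * x j].
Proof.
have posE : cv_gt0 (restrict J x) <-> positive_on J x.
  rewrite /positive_on -forall_enum_val.
  by split=> h i; move/(_ i): h; rewrite mxE.
have offE : cv_ge0 (offsupport_submx A J *m restrict J x) <->
    forall i, i \notin J -> 0 <= \sum_(j in J) A i j * x j.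
  rewrite (_ : (forall i, i \notin J -> _) <->
    (forall i, i \in ~: J -> 0 <= \sum_(j in J) A i j * x j)); last first.
    by split=> h i iJ; apply: h; move: iJ; rewrite finset.in_setC.
  rewrite -forall_enum_val.
  by split=> h i; move/(_ i): h; rewrite mxsub_enum_val.
split=> [] [/eigen_restrictP e p o]; split=> //; by [exact/posE|exact/offE].
Qed.

Lemma produced_valuesP A J lam : produced_values A J lam <->
  J <> finset.set0 /\ exists x, [/\ eigen_on A J lam x, positive_on J x
    & forall i, i \notin J -> 0 <= \sum_(j in J) A i j * x j].
Proof.
split=> -[J0 [u]]; last by move=> h; split=> //; exists (restrict J u); apply/producesP.
by have [x ->] := restrictP u J0 => /producesP h; split=> //; exists x.
Qed.

Lemma regularly_produced_on A J lam x : J <> finset.set0 ->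
    simple_eigenvalue (principal_submx A J) lam ->
    eigen_on A J lam x -> positive_on J x ->
    (forall i, i \notin J -> 0 < \sum_(j in J) A i j * x j) ->
  regularly_produced A J lam.
Proof.
move=> J0 sl ex px ox; split=> //; exists (restrict J x).
  by apply/producesP; split=> // i /ox /ltW.
move=> i; rewrite mxsub_enum_val; apply: ox.
by have := enum_valP i; rewrite finset.in_setC.
Qed.

Lemma root_char_poly_on A J lam x i : i \in J -> x i != 0 ->
  eigen_on A J lam x -> root (char_poly (principal_submx A J)) lam.
Proof.
move=> Ji xi /eigen_restrictP e.
(* [eigenvalueP] speaks of row vectors, so the column eigenvector is transposed and the
   characteristic polynomial is taken of the transposed submatrix. *)
rewrite /root /char_poly -det_tr.
have -> : \det (char_poly_mx (principal_submx A J))^T =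
          char_poly (principal_submx A J)^T.
  rewrite /char_poly; congr (\det _); apply/matrixP => a b.
  by rewrite !mxE eq_sym.
rewrite -/(root _ _) -eigenvalue_root_char; apply/eigenvalueP.
exists (restrict J x)^T; first by rewrite -trmx_mul e linearZ.
apply: contra xi => /eqP/rowP/(_ (enum_rank_in Ji i)).
by rewrite !mxE enum_rankK_in // => ->.
Qed.

(** Distinct eigenvalues are distinct roots of the characteristic polynomial, whose degree is
    [#|J|]. *)
Lemma eigenvalues_on_le A J (s : seq R) : uniq s ->
    (forall lam, lam \in s -> eigenvalue_on A J lam) ->
  (size s <= #|J|)%N.
Proof.
move=> us es; rewrite -ltnS -(size_char_poly (principal_submx A J)).
apply: max_poly_roots => //; first exact/monic_neq0/char_poly_monic.
by apply/allP => lam /es[x [[i Ji xi]]]; apply: root_char_poly_on Ji xi.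
Qed.

(* A list of [#|J|] distinct eigenvalues leaves no room for multiplicities. *)
Lemma simple_eigenvalue_on A J (s : seq R) lam : uniq s -> size s = #|J| ->
    (forall lam, lam \in s -> eigenvalue_on A J lam) ->
  lam \in s -> simple_eigenvalue (principal_submx A J) lam.
Proof.
move=> us sz es ls; rewrite /simple_eigenvalue.
have -> : char_poly (principal_submx A J) = \prod_(z <- s) ('X - z%:P).
  rewrite [LHS](@all_roots_prod_XsubC _ _ s) ?uniq_rootsE //.
  - by rewrite (monicP (char_poly_monic _)) scale1r.
  - by rewrite size_char_poly sz.
  - by apply/allP => m /es[x [[i Ji xi]]]; apply: root_char_poly_on Ji xi.
rewrite (bigD1_seq lam) //= mupMl.
  by rewrite -[X in mup _ X]expr1 mup_XsubCX eqxx.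
rewrite /root horner_prod prodf_seq_neq0; apply/allP => m _; apply/implyP => ml.
by rewrite !hornerE subr_eq0 eq_sym.
Qed.

Lemma produced_eigenvalue A J lam : produced_values A J lam -> eigenvalue_on A J lam.
Proof.
case/produced_valuesP => /eqP/set0Pn[i Ji] [x [ex px _]].
by exists x; split=> //; exists i; rewrite // gt_eqF ?px.
Qed.

(** A produced value outside [s] would be one eigenvalue too many. Locating all eigenvalues of a
    principal submatrix thus limits what its support can produce. *)
Lemma produced_mem A J (s : seq R) lam : uniq s -> size s = #|J| ->
    (forall mu, mu \in s -> eigenvalue_on A J mu) ->
  produced_values A J lam -> lam \in s.
Proof.
move=> us sz es h; apply: contraT => ls.
suff : (size (lam :: s) <= #|J|)%N by rewrite /= sz ltnn.
apply: (eigenvalues_on_le (A := A)); first by rewrite /= ls us.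
by move=> mu; rewrite inE => /orP[/eqP->|/es//]; exact: produced_eigenvalue.
Qed.

(** The eigenvector is extended by zero: on [J] the residual vanishes, off [J] the vector does, so
    the scalar product is zero term by term. *)
Lemma produced_pareto A J lam : produced_values A J lam -> pareto_eigenvalue A lam.
Proof.
case/produced_valuesP => /eqP/set0Pn[i0 Ji0] [x [ex px ox]].
pose y : 'cV[R]_n := \col_i (if i \in J then x i else 0).
have Ay i : (A *m y - lam *: y) i 0 =
    if i \in J then 0 else \sum_(j in J) A i j * x j.
  rewrite !mxE; have -> : \sum_j A i j * y j 0 = \sum_(j in J) A i j * x j.
    rewrite [RHS]big_mkcond /=; apply: eq_bigr => j _.
    by rewrite mxE; case: ifP => _ //; rewrite mulr0.
  case: ifP => iJ; last by rewrite mulr0 subr0.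
  by rewrite ex // subrr.
exists y; split.
- by move=> /colP/(_ i0); rewrite !mxE Ji0 => x0; have := px _ Ji0; rewrite x0 ltxx.
- by move=> i; rewrite mxE; case: ifP => // /px/ltW.
- by move=> i; rewrite Ay; case: ifPn => // /ox.
- rewrite /dotcv big1 // => i _; rewrite Ay mxE; case: ifP => _.
  + by rewrite mulr0.
  + by rewrite mul0r.
Qed.

(** The support is the set of nonzero coordinates of [x]. The terms of the vanishing scalar product
    are nonnegative, so each is zero and the eigenvalue equation holds wherever [x] is nonzero. *)
Lemma pareto_produced A lam : pareto_eigenvalue A lam ->
  exists J, produced_values A J lam.
Proof.
case=> x [x0 xge wge dot0]; pose J : {set 'I_n} := [set i | x i 0 != 0]%SET.
have sumJ i : \sum_(j in J) A i j * x j 0 = (A *m x) i 0.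
  rewrite mxE [LHS]big_mkcond /=; apply: eq_bigr => j _.
  by rewrite inE; case: eqP => [->|//]; rewrite mulr0.
have xw i : x i 0 * (A *m x - lam *: x) i 0 = 0.
  apply/eqP; move: dot0 => /eqP; rewrite /dotcv psumr_eq0.
    by move=> /allP/(_ i); rewrite mem_index_enum; apply.
  by move=> j _; apply: mulr_ge0; [exact: xge|exact: wge].
exists J; apply/produced_valuesP; split.
  move=> J0; apply: x0; apply/colP => i; rewrite mxE; apply/eqP.
  by have := finset.in_set0 i; rewrite -J0 inE => /negbFE.
exists (fun i => x i 0); split.
- move=> i; rewrite inE => xi; rewrite sumJ; have /eqP := xw i.
  by rewrite mulf_eq0 (negPf xi) /= !mxE subr_eq0 => /eqP.
- by move=> i; rewrite inE => xi; rewrite lt_def xi; exact: xge.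
- move=> i; rewrite inE negbK => /eqP xi; rewrite sumJ.
  by have := wge i; rewrite !mxE xi mulr0 subr0.
Qed.

End Supports.

(** * Sets with at most k elements *)

Section AtMost.
Context {T : eqType}.
Implicit Types (S : set T) (k : nat).

(** Bounds are expressed by covering lists: unions become concatenations, and distinct elements can
    be extracted when a bound fails. *)
Definition atmost S k : Prop :=
  exists2 s : seq T, (size s <= k)%N & forall x, S x -> x \in s.

Lemma atmostP S k :
  (forall s : seq T, uniq s -> (forall x, x \in s -> S x) -> (size s <= k)%N) ->
  atmost S k.
Proof.
move=> h; apply: contrapT => nS.
(* If no list of length at most [k] covers [S], a list of distinct elements of [S] can always be
   prolonged, against [h]; the alternative [atmost S k] is excluded by [nS]. *)
have large m : exists s : seq T,
    [/\ uniq s, size s = m & forall x, x \in s -> S x] \/ atmost S k.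
  elim: m => [|m [s [[us sm sS]|//]]]; first by exists [::]; left.
  have [sm_le|] := leqP (size s) k; last first.
    by rewrite ltnNge h.
  have [x Sx xs] : exists2 x, S x & x \notin s.
    apply: contrapT => nx; apply: nS; exists s => // x Sx.
    by apply: contraT => xs; case: nx; exists x.
  exists (x :: s); left; split=> /=; [by rewrite xs|by rewrite sm|].
  by move=> y; rewrite inE => /orP[/eqP->//|/sS].
have [s [[us sk sS]|//]] := large k.+1.
by have := h s us sS; rewrite sk ltnn.
Qed.

Lemma atmostPn S k : ~ atmost S k ->
  exists s : seq T, [/\ uniq s, size s = k.+1 & forall x, x \in s -> S x].
Proof.
move=> nS; apply: contrapT => ns; apply: nS; apply: atmostP => s us sS.
rewrite leqNgt; apply/negP => sk; apply: ns; exists (take k.+1 s); split.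
- exact: take_uniq.
- by rewrite size_takel.
- by move=> x /mem_take/sS.
Qed.

Lemma atmost_sub S S' k : S `<=` S' -> atmost S' k -> atmost S k.
Proof. by move=> SS' [s sk sS]; exists s => // x /SS'/sS. Qed.

Lemma atmostU S S' k k' : atmost S k -> atmost S' k' -> atmost (S `|` S') (k + k').
Proof.
move=> [s sk sS] [s' sk' sS']; exists (s ++ s').
  by rewrite size_cat leq_add.
by move=> x [/sS|/sS'] xs; rewrite mem_cat xs ?orbT.
Qed.

Lemma atmost_leq S k k' : (k <= k')%N -> atmost S k -> atmost S k'.
Proof. by move=> kk' [s sk sS]; exists s => //; apply: leq_trans kk'. Qed.

Lemma atmost0 S : (forall x, ~ S x) -> atmost S 0.
Proof. by move=> S0; exists [::] => // x /S0. Qed.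

Lemma has_card_seq (s : seq T) : uniq s -> has_card [set` s] (size s).
Proof.
move=> us; rewrite /has_card.
(* The empty list is treated apart because [nth], which enumerates the other lists, needs a default
   element of [T]. *)
have [->|s0] := eqVneq s [::].
  by rewrite II0 (_ : [set` [::]] = set0) // -subset0 => x /=; rewrite in_nil.
case: s us s0 => // x0 s us _.
set t := x0 :: s in us *.
have -> : [set` t] = nth x0 t @` `I_(size t).
  apply/seteqP; split=> [x /= xt|_ [i /= it <-]]; last exact: mem_nth.
  by exists (index x t); [by rewrite -index_mem in xt|exact: nth_index].
apply: inj_card_eq => i j; rewrite !inE /= => si sj /eqP.
by rewrite nth_uniq // => /eqP.
Qed.

Lemma atmost_card_le S k : atmost S k -> (S #<= `I_k)%card.
Proof.
move=> [s sk sS]; apply: (@card_le_trans _ _ _ [set` undup s]).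
  by apply: subset_card_le => x /sS /=; rewrite mem_undup.
have := has_card_seq (undup_uniq s); rewrite /has_card card_eq_le => /andP[le1 _].
apply: (card_le_trans le1); rewrite card_le_II.
exact: leq_trans (size_undup s) sk.
Qed.

End AtMost.

(** * Production in dimension three *)

Section Dimension3.
Context {R : realType}.
Implicit Types (A : 'M[R]_3) (i j k l : 'I_3) (lam : R) (x : 'I_3 -> R).

(** Indices with [uniq [:: i; j; k]] stand for an arbitrary numbering of ['I_3], so that one
    statement serves all permutations. *)
Lemma distinct3P i j k : uniq [:: i; j; k] -> [/\ i != j, i != k & j != k].
Proof. by rewrite /= !inE negb_or andbT => /andP[/andP[]]. Qed.

Lemma distinct3_mem i j k l : uniq [:: i; j; k] -> l \in [:: i; j; k].
Proof. by move: i j k l; do 4! case=> [[|[|[|//]]] ?]. Qed.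

Lemma sum3 i j k (F : 'I_3 -> R) : uniq [:: i; j; k] ->
  \sum_l F l = F i + F j + F k.
Proof.
move=> u; rewrite (eq_bigl (mem [:: i; j; k])); last first.
  by move=> l; rewrite /= distinct3_mem.
by rewrite -big_uniq // !big_cons big_nil /= addr0 addrA.
Qed.

Lemma sum2 i j (F : 'I_3 -> R) : i != j ->
  \sum_(l in [set i; j]%SET) F l = F i + F j.
Proof. by move=> ij; rewrite big_setU1 ?big_set1 // inE. Qed.

Lemma singleP A i j k lam : uniq [:: i; j; k] ->
  produced_values A [set i]%SET lam <->
  [/\ lam = A i i, 0 <= A j i & 0 <= A k i].
Proof.
move=> u; have [ij ik jk] := distinct3P u.
rewrite produced_valuesP; split.
  move=> [_ [x [ex px ox]]].
  have xi : 0 < x i by apply: px; rewrite inE.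
  have := ex i; have := ox j; have := ox k.
  rewrite !inE !big_set1 eqxx eq_sym ik eq_sym ij => /(_ isT) ok /(_ isT) oj /(_ isT) e.
  rewrite -(pmulr_lge0 _ xi) oj -(pmulr_lge0 _ xi) ok; split=> //.
  by apply: (mulIf (lt0r_neq0 xi)); rewrite e.
move=> [-> ji ki]; split; first by apply/eqP/set0Pn; exists i; rewrite inE.
exists (fun=> 1); split=> // l; rewrite !inE ?big_set1 //; first by move=> /eqP->.
by have := distinct3_mem l u; rewrite !inE mulr1 => /or3P[] /eqP->; rewrite ?eqxx.
Qed.

Lemma pairP A i j k lam : uniq [:: i; j; k] ->
  produced_values A [set i; j]%SET lam <->
  exists u v, [/\ 0 < u /\ 0 < v, A i i * u + A i j * v = lam * u,
    A j i * u + A j j * v = lam * v & 0 <= A k i * u + A k j * v].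
Proof.
move=> un; have [ij ik jk] := distinct3P un.
rewrite produced_valuesP; split.
  move=> [_ [x [ex px ox]]]; exists (x i), (x j).
  have S l : \sum_(m in [set i; j]%SET) A l m * x m = A l i * x i + A l j * x j.
    exact: sum2.
  have iI : i \in [set i; j]%SET by rewrite !inE eqxx.
  have jI : j \in [set i; j]%SET by rewrite !inE eqxx orbT.
  have kI : k \notin [set i; j]%SET by rewrite !inE ![k == _]eq_sym negb_or ik.
  by rewrite -!S (ex i) ?(ex j) //; split; [split; exact: px| | |exact: ox].
move=> [u [v [[u0 v0] e1 e2 e3]]].
split; first by apply/eqP/set0Pn; exists i; rewrite !inE eqxx.
exists (fun l => if l == i then u else v); split=> l.
- by rewrite sum2 // eqxx [j == i]eq_sym (negPf ij) !inE => /orP[]/eqP->;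
    rewrite ?eqxx // [j == i]eq_sym (negPf ij).
- by case: ifP.
- rewrite sum2 // eqxx [j == i]eq_sym (negPf ij) !inE.
  by have := distinct3_mem l un; rewrite !inE => /or3P[] /eqP->; rewrite ?eqxx ?orbT.
Qed.

Lemma tripleP A i j k lam : uniq [:: i; j; k] ->
  produced_values A [set: 'I_3]%SET lam <->
  exists u v w, [/\ [/\ 0 < u, 0 < v & 0 < w],
    A i i * u + A i j * v + A i k * w = lam * u,
    A j i * u + A j j * v + A j k * w = lam * v &
    A k i * u + A k j * v + A k k * w = lam * w].
Proof.
move=> un; have [ij ik jk] := distinct3P un.
have sumT l x : \sum_(m in [set: 'I_3]%SET) A l m * x m =
    A l i * x i + A l j * x j + A l k * x k.
  by rewrite -(sum3 (fun m => A l m * x m) un); apply: eq_bigl => m; rewrite inE.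
rewrite produced_valuesP; split.
  move=> [_ [x [ex px ox]]]; exists (x i), (x j), (x k).
  have px' l : 0 < x l by apply: px; rewrite inE.
  by rewrite -!sumT !ex ?inE //; split.
move=> [u [v [w [[u0 v0 w0] e1 e2 e3]]]].
split; first by apply/eqP/set0Pn; exists i; rewrite !inE.
exists (fun l => if l == i then u else if l == j then v else w); split=> l.
- rewrite sumT !eqxx [j == i]eq_sym [k == i]eq_sym [k == j]eq_sym (negPf ij) (negPf ik) (negPf jk) => _.
  by have := distinct3_mem l un; rewrite !inE => /or3P[] /eqP->;
    rewrite ?eqxx // eq_sym ?(negPf ij) ?(negPf ik) // eq_sym (negPf jk).
- by do 2?case: ifP.
- by rewrite inE.
Qed.

Lemma support3_cases i j k (J : {set 'I_3}) : uniq [:: i; j; k] ->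
    J <> finset.set0 ->
  J \in [:: [set i]; [set j]; [set k]; [set i; j]; [set i; k]; [set j; k];
    [set: 'I_3]]%SET.
Proof.
move=> un J0; have [ij ik jk] := distinct3P un.
have eqJ (J' : {set 'I_3}) :
    [&& (i \in J) == (i \in J'), (j \in J) == (j \in J')
      & (k \in J) == (k \in J')] -> J = J'.
  move=> /and3P[/eqP ei /eqP ej /eqP ek]; apply/setP => l.
  by have := distinct3_mem l un; rewrite !inE => /or3P[] /eqP->.
have : J != finset.set0 by apply/eqP.
case iJ: (i \in J) (eqJ); case jJ: (j \in J); case kJ: (k \in J) => {}eqJ nJ.
- by rewrite (eqJ [set: 'I_3]%SET) ?inE // !eqxx ?orbT.
- by rewrite (eqJ [set i; j]%SET) !inE ?eqxx ?orbT // ![k == _]eq_sym (negPf ik) (negPf jk).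
- by rewrite (eqJ [set i; k]%SET) !inE ?eqxx ?orbT // [j == i]eq_sym (negPf ij) (negPf jk).
- by rewrite (eqJ [set i]%SET) !inE ?eqxx ?orbT // ![_ == i]eq_sym (negPf ij) (negPf ik).
- by rewrite (eqJ [set j; k]%SET) !inE ?eqxx ?orbT // (negPf ij) (negPf ik).
- by rewrite (eqJ [set j]%SET) !inE ?eqxx ?orbT // (negPf ij) [k == j]eq_sym (negPf jk).
- by rewrite (eqJ [set k]%SET) !inE ?eqxx ?orbT // (negPf ik) (negPf jk).
- by move: nJ; rewrite (eqJ finset.set0) ?eqxx // !inE.
Qed.

End Dimension3.

(** * At most nine Pareto eigenvalues *)

Section RealAlgebra.
Context {R : realFieldType}.
Implicit Types (a b p q r s t v x y : R).

(** Divided differences: subtracting the equations at two roots and cancelling the difference of the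
    roots lowers the degree. The second difference gives [c2], and then [c1] and [c0] follow. *)
Lemma cubic_vieta (c2 c1 c0 n1 n2 n3 : R) :
    n1 != n2 -> n1 != n3 -> n2 != n3 ->
    (forall n, n \in [:: n1; n2; n3] -> n ^+ 3 - c2 * n ^+ 2 + c1 * n - c0 = 0) ->
  c2 = n1 + n2 + n3 /\
  forall x, x ^+ 3 - c2 * x ^+ 2 + c1 * x - c0 = (x - n1) * (x - n2) * (x - n3).
Proof.
rewrite -(subr_eq0 n1 n2) -(subr_eq0 n1 n3) -(subr_eq0 n2 n3) => n12 n13 n23 h.
have h1 := h n1; have h2 := h n2; have h3 := h n3.
rewrite !inE !eqxx ?orbT in h1 h2 h3.
move: {h} (h1 isT) (h2 isT) (h3 isT) => {}h1 {}h2 {}h3.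
have d12 : n1 ^+ 2 + n1 * n2 + n2 ^+ 2 - c2 * (n1 + n2) + c1 = 0.
  by apply: (mulfI n12); lra.
have d13 : n1 ^+ 2 + n1 * n3 + n3 ^+ 2 - c2 * (n1 + n3) + c1 = 0.
  by apply: (mulfI n13); lra.
have d123 : n1 + n2 + n3 - c2 = 0 by apply: (mulfI n23); lra.
have e2 : c2 = n1 + n2 + n3 by lra.
rewrite e2 in d12 h1 *; split=> // x.
have e1 : c1 = n1 * n2 + n1 * n3 + n2 * n3 by lra.
rewrite e1 in h1 *.
have e0 : c0 = n1 * n2 * n3 by lra.
by rewrite e0; ring.
Qed.

(* The matrix is [[a, p, -r], [q, b, -s], [t, v, 0]]; l1, l2 are produced by
   {1,3}, m1, m2 by {2,3} and n1, n2, n3 by {1,2,3}.  Multiplied by the variable,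
   the characteristic polynomial is
   [(x - l1)(x - l2)(x - m1)(x - m2) - (p x - r v)(q x - s t)], nonnegative at
   [y = s t / q], which bounds all the eigenvalues considered from below. *)
Lemma no_tenth_value_ordered a b p q r s t v l1 l2 m1 m2 n1 n2 n3 :
    [/\ 0 < q, 0 < s & 0 < t] ->
    l1 <= l2 -> m1 <= m2 -> l1 <= m1 ->
    a = l1 + l2 -> b = m1 + m2 -> r * t = l1 * l2 -> s * v = m1 * m2 ->
    s * t <= q * l1 ->
    n1 != n2 -> n1 != n3 -> n2 != n3 ->
    (forall n, n \in [:: n1; n2; n3] -> exists w1 w2 w3,
      [/\ [/\ 0 < w1, 0 < w2 & 0 < w3], a * w1 + p * w2 - r * w3 = n * w1,
        q * w1 + b * w2 - s * w3 = n * w2 & t * w1 + v * w2 = n * w3]) ->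
  False.
Proof.
move=> [q0 s0 t0] l12 m12 l1m1 ea eb ert esv row n12 n13 n23 trip.
pose y := s * t / q.
have yE : q * y = s * t by rewrite /y mulrC divfK // gt_eqF.
have y0 : 0 < y by rewrite /y divr_gt0 ?mulr_gt0.
have yl1 : y <= l1 by rewrite /y ler_pdivrMr // [l1 * _]mulrC.
pose F x := (x - l1) * (x - l2) * ((x - m1) * (x - m2)) -
  (p * x - r * v) * (q * x - s * t).
(* Multiplying the first two rows by [n] and replacing [n * w3] from the third row eliminates [w3];
   the sums and products of [l1, l2] and of [m1, m2] then factor the left sides. *)
have pos n : n \in [:: n1; n2; n3] -> exists w1 w2, [/\ 0 < w1, 0 < w2,
    (n - l1) * (n - l2) * w1 = (p * n - r * v) * w2 &
    (n - m1) * (n - m2) * w2 = (q * n - s * t) * w1].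
  move=> /trip [w1 [w2 [w3 [[w10 w20 w30] e1 e2 e3]]]]; exists w1, w2; split=> //.
    have h1 := congr1 ( *%R n) e1; have h3 := congr1 ( *%R r) e3.
    have h := congr1 ( *%R w1) ert; rewrite ea in h1; lra.
  have h2 := congr1 ( *%R n) e2; have h3 := congr1 ( *%R s) e3.
  have h := congr1 ( *%R w2) esv; rewrite eb in h2; lra.
(* For [n < y], both [n - m1] and [n - m2] are negative since [y <= l1 <= m1 <= m2], so the second
   relation would equate a positive number with a nonpositive one. *)
have y_le n : n \in [:: n1; n2; n3] -> y <= n.
  move=> /pos [w1 [w2 [w10 w20 _ e]]]; rewrite leNgt; apply/negP => ny.
  have : 0 < (n - m1) * (n - m2) * w2.
    by rewrite mulr_gt0 // nmulr_rgt0; lra.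
  rewrite e ltNge => /negP; apply; rewrite mulr_le0_ge0 ?(ltW w10) //.
  by rewrite -yE -mulrBr pmulr_rle0 //; lra.
have F0 n : n \in [:: n1; n2; n3] -> F n = 0.
  move=> /pos [w1 [w2 [w10 w20 e1 e2]]].
  have w120 : w1 * w2 != 0 by rewrite mulf_neq0 ?gt_eqF.
  apply: (mulIf w120); rewrite mul0r /F.
  transitivity ((n - l1) * (n - l2) * w1 * ((n - m1) * (n - m2) * w2) -
    (p * n - r * v) * w2 * ((q * n - s * t) * w1)); first by ring.
  by rewrite e1 e2 subrr.
pose c1 := (l1 + l2) * (m1 + m2) + l1 * l2 + m1 * m2 - p * q.
pose c0 := l1 * l2 * (m1 + m2) + m1 * m2 * (l1 + l2) - p * (s * t) - q * (r * v).
have FE x : F x = x * (x ^+ 3 - (l1 + l2 + m1 + m2) * x ^+ 2 + c1 * x - c0).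
  have h : r * v * (s * t) = l1 * l2 * (m1 * m2) by rewrite -ert -esv; ring.
  by rewrite /F /c1 /c0; ring: h.
(* The eigenvalues are at least [y > 0], so the factor [x] of [FE] can be cancelled at each of
   them. *)
have [tr chi] := cubic_vieta n12 n13 n23 (c2 := l1 + l2 + m1 + m2) (c1 := c1)
  (c0 := c0) (fun n hn => mulfI (lt0r_neq0 (lt_le_trans y0 (y_le n hn)))
    (etrans (esym (FE n)) (etrans (F0 n hn) (esym (mulr0 n))))).
have in1 : n1 \in [:: n1; n2; n3] by rewrite !inE eqxx.
have in2 : n2 \in [:: n1; n2; n3] by rewrite !inE eqxx orbT.
have in3 : n3 \in [:: n1; n2; n3] by rewrite !inE eqxx !orbT.
have Fy_ge0 : 0 <= F y.
  rewrite /F yE subrr mulr0 subr0 mulr_ge0 // mulr_le0; lra.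
(* By [chi], [F y] is [y] times three nonpositive factors. With the opposite inequality one of them
   vanishes, so [y] is an eigenvalue. *)
have Fy_le0 : F y <= 0.
  rewrite FE chi pmulr_rle0 // mulr_ge0_le0 ?mulr_le0 ?subr_le0 ?y_le //.
have y_root : (y - n1) * (y - n2) * (y - n3) = 0.
  have /eqP : F y = 0 by apply: le_anti; rewrite Fy_ge0 Fy_le0.
  by rewrite FE chi mulf_eq0 gt_eqF //= => /eqP.
(* If y is itself an eigenvalue, it is a double root. *)
have absurd n n' n'' : n \in [:: n1; n2; n3] -> n' \in [:: n1; n2; n3] ->
    n'' \in [:: n1; n2; n3] -> n' - n != 0 -> n'' - n != 0 -> n' - n'' != 0 ->
    l1 + l2 + m1 + m2 = n + n' + n'' -> y - n = 0 -> False.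
  move=> hn hn' hn'' dn' dn'' dnn tr' yn.
  have ny : n = y by lra.
  have [w1 [w2 [w10 w20]]] := pos n hn.
  rewrite ny yE subrr mul0r => e1 /eqP.
  rewrite mulf_eq0 [w2 == 0]gt_eqF // orbF mulf_eq0 => ym.
  (* If instead [y = m2], the chain [y <= l1 <= m1 <= m2] collapses to equalities. *)
  have ym1 : y = m1 by case/orP: ym => /eqP ?; lra.
  have yl : y = l1 by lra.
  move: e1; rewrite -yl subrr !mul0r => /esym/eqP.
  rewrite mulf_eq0 [w2 == 0]gt_eqF // orbF subr_eq0 => /eqP rvE.
  (* Now [F x] is [(x - y) ^+ 2] times [(x - l2) * (x - m2) - p * q]. The other two eigenvalues
     therefore sum to [l2 + m2], and the trace relation leaves [y = 0]. *)
  have quad m : m \in [:: n1; n2; n3] -> m - n != 0 -> (m - l2) * (m - m2) = p * q.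
    move=> /F0 + mn; rewrite /F -rvE -yE -yl -ym1 => e.
    rewrite ny in mn.
    by apply: (mulfI mn); apply: (mulfI mn); lra.
  have q' := quad _ hn' dn'; have q'' := quad _ hn'' dn''.
  have : n' + n'' - l2 - m2 = 0 by apply: (mulfI dnn); lra.
  lra.
move: y_root n12 n13 n23; rewrite -(subr_eq0 n1 n2) -(subr_eq0 n1 n3) -(subr_eq0 n2 n3).
move=> /eqP; rewrite !mulf_eq0 => /orP[/orP[]|] /eqP yn d12 d13 d23.
- by apply: (absurd n1 n2 n3 in1 in2 in3) yn => //; rewrite -opprB oppr_eq0.
- by apply: (absurd n2 n1 n3 in2 in1 in3) yn => //; [rewrite -opprB oppr_eq0|lra].
- by apply: (absurd n3 n1 n2 in3 in1 in2) yn => //; lra.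
Qed.
End RealAlgebra.

(** * Counting the values of a matrix of order three *)

Section Capacity3.
Context {R : realType}.
Implicit Types (A : 'M[R]_3) (i j k : 'I_3) (lam : R).

(** The pair matrix is [[[a, -r], [t, 0]]] and [(q, -s)] is the row outside. Sum and product come
    from the quadratic; the row [t * u = l * w] excludes [t = 0], which would make both values zero,
    and fixes [u / w] as [l / t], which turns the outside inequality into one on [l]. *)
Lemma two_values_pair (a q r s t l1 l2 : R) : 0 <= t -> l1 != l2 ->
    (forall l, l \in [:: l1; l2] -> exists u w, [/\ 0 < u /\ 0 < w,
       a * u - r * w = l * u, t * u = l * w & 0 <= q * u - s * w]) ->
  [/\ a = l1 + l2, r * t = l1 * l2, 0 < t &
    forall l, l \in [:: l1; l2] -> 0 < l /\ s * t <= q * l].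
Proof.
move=> t_ge0; rewrite -(subr_eq0 l1 l2) => l12 h.
have quad l : l \in [:: l1; l2] -> l ^+ 2 - a * l + r * t = 0.
  move=> /h [u [w [[u0 w0] e1 e2 _]]].
  have wn0 : w != 0 by rewrite gt_eqF.
  apply: (mulfI wn0).
  have h1 := congr1 ( *%R t) e1.
  have h2 := congr1 ( *%R (l - a)) e2; lra.
have q1 := quad l1; have q2 := quad l2; rewrite !inE !eqxx orbT in q1 q2.
move: {q1 q2 quad} (q1 isT) (q2 isT) => q1 q2.
have ea : a = l1 + l2.
  by apply/eqP; rewrite eq_sym -subr_eq0; apply/eqP; apply: (mulfI l12); lra.
have t0 : 0 < t.
  rewrite lt_def t_ge0 andbT; apply: contra l12 => /eqP tE.
  have z l : l \in [:: l1; l2] -> l = 0.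
    move=> /h [u [w [[u0 w0] _ + _]]]; rewrite tE mul0r => /esym/eqP.
    by rewrite mulf_eq0 [w == 0]gt_eqF // orbF => /eqP.
  have z1 : l1 = 0 by apply: z; rewrite !inE eqxx.
  have z2 : l2 = 0 by apply: z; rewrite !inE eqxx orbT.
  by rewrite z1 z2 subrr.
split=> //; first by rewrite ea in q1; lra.
move=> l /h [u [w [[u0 w0] _ e2 e3]]]; split.
  by rewrite -(pmulr_lgt0 _ w0) -e2 mulr_gt0.
rewrite -(ler_pM2r w0).
have := mulr_ge0 (ltW t0) e3; have := congr1 ( *%R q) e2; lra.
Qed.

(** Subtracting [c = A k k] from the diagonal shifts every value by [c] and gives the normal form
    with zero corner. The strict signs required there follow from the positivity of the shifted pair
    values. *)
Lemma no_tenth_value_lt A i j k (l1 l2 m1 m2 n1 n2 n3 : R) :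
    uniq [:: i; j; k] -> 0 <= A k i -> 0 <= A k j ->
    l1 < l2 -> m1 < m2 -> l1 <= m1 -> n1 != n2 -> n1 != n3 -> n2 != n3 ->
    (forall l, l \in [:: l1; l2] -> produced_values A [set i; k]%SET l) ->
    (forall m, m \in [:: m1; m2] -> produced_values A [set j; k]%SET m) ->
    (forall n, n \in [:: n1; n2; n3] -> produced_values A [set: 'I_3]%SET n) ->
  False.
Proof.
move=> un Aki Akj l12 m12 l1m1 n12 n13 n23 hl hm hn.
have [ij ik jk] := distinct3P un; pose c := A k k.
have un1 : uniq [:: i; k; j] by rewrite /= !inE negb_or ij ik eq_sym jk.
have un2 : uniq [:: j; k; i].
  by rewrite /= !inE negb_or jk eq_sym ij eq_sym ik.
have [||la rt t0 lrow] := @two_values_pair (A i i - c) (A j i) (- A i k) (- A j k)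
    (A k i) (l1 - c) (l2 - c) Aki.
- by rewrite (inj_eq (addIr _)) lt_eqF.
- move=> l lE; have /hl : l + c \in [:: l1; l2].
    by move: lE; rewrite !inE => /orP[] /eqP->; rewrite subrK eqxx ?orbT.
  move=> /(pairP _ _ un1) [u [w [uw e1 e2 e3]]].
  by exists u, w; split=> //; rewrite /c in e1 e2 *; lra.
have [||ma sv v0 mrow] := @two_values_pair (A j j - c) (A i j) (- A j k) (- A i k)
    (A k j) (m1 - c) (m2 - c) Akj.
- by rewrite (inj_eq (addIr _)) lt_eqF.
- move=> l lE; have /hm : l + c \in [:: m1; m2].
    by move: lE; rewrite !inE => /orP[] /eqP->; rewrite subrK eqxx ?orbT.
  move=> /(pairP _ _ un2) [u [w [uw e1 e2 e3]]].
  by exists u, w; split=> //; rewrite /c in e1 e2 *; lra.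
have [l10 l1row] := lrow (l1 - c) ltac:(by rewrite inE eqxx).
have [m10 _] := mrow (m1 - c) ltac:(by rewrite inE eqxx).
have m20 : 0 < m2 - c by lra.
have s0 : 0 < - A j k by rewrite -(pmulr_lgt0 _ v0) sv mulr_gt0.
have q0 : 0 < A j i.
  by rewrite -(pmulr_lgt0 _ l10) (lt_le_trans _ l1row) // mulr_gt0.
apply: (@no_tenth_value_ordered _ (A i i - c) (A j j - c) (A i j) (A j i)
  (- A i k) (- A j k) (A k i) (A k j) (l1 - c) (l2 - c) (m1 - c) (m2 - c)
  (n1 - c) (n2 - c) (n3 - c)) => //; rewrite ?(inj_eq (addIr _)) //; try lra.
move=> n nE; have /hn : n + c \in [:: n1; n2; n3].
  by move: nE; rewrite !inE => /or3P[] /eqP->; rewrite subrK eqxx ?orbT.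
move=> /(tripleP _ _ un) [u [v [w [uvw e1 e2 e3]]]].
by exists u, v, w; split=> //; rewrite /c in e1 e2 e3 *; lra.
Qed.

(** The order of the values is a matter of naming: the two values of a pair may be exchanged, and so
    may [i] and [j], in which the hypotheses are symmetric. *)
Lemma no_tenth_value A i j k (l1 l2 m1 m2 n1 n2 n3 : R) :
    uniq [:: i; j; k] -> 0 <= A k i -> 0 <= A k j ->
    l1 != l2 -> m1 != m2 -> n1 != n2 -> n1 != n3 -> n2 != n3 ->
    (forall l, l \in [:: l1; l2] -> produced_values A [set i; k]%SET l) ->
    (forall m, m \in [:: m1; m2] -> produced_values A [set j; k]%SET m) ->
    (forall n, n \in [:: n1; n2; n3] -> produced_values A [set: 'I_3]%SET n) ->
  False.
Proof.
move=> un ki kj l12 m12 n12 n13 n23 hl hm hn.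
wlog ltl : l1 l2 hl l12 / l1 < l2.
  move=> hw; have [/hw|/hw|e] := ltgtP l1 l2; [exact|apply|by rewrite e eqxx in l12].
    by move=> l; rewrite !inE orbC => e; apply: hl; rewrite !inE.
  by rewrite eq_sym.
wlog ltm : m1 m2 hm m12 / m1 < m2.
  move=> hw; have [/hw|/hw|e] := ltgtP m1 m2; [exact|apply|by rewrite e eqxx in m12].
    by move=> l; rewrite !inE orbC => e; apply: hm; rewrite !inE.
  by rewrite eq_sym.
have [l1m1|/ltW m1l1] := leP l1 m1.
  exact: (no_tenth_value_lt un ki kj ltl ltm l1m1 n12 n13 n23 hl hm hn).
have [ij ik jk] := distinct3P un.
have un' : uniq [:: j; i; k] by rewrite /= !inE negb_or eq_sym ij ik jk.
exact: (no_tenth_value_lt un' kj ki ltm ltl m1l1 n12 n13 n23 hm hl hn).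
Qed.

Lemma atmost_produced A (J : {set 'I_3}) : atmost (produced_values A J) #|J|.
Proof.
apply: atmostP => s us sJ; apply: (eigenvalues_on_le us (A := A)) => lam /sJ.
exact: produced_eigenvalue.
Qed.

(** The Boolean serves as the bound 0 or 1. *)
Lemma atmost_single A i j k : uniq [:: i; j; k] ->
  atmost (produced_values A [set i]%SET) ((0 <= A j i) && (0 <= A k i)).
Proof.
move=> un; have [/andP[ji ki]|nN] := boolP (_ && _).
  by have := atmost_produced A [set i]; rewrite cards1.
by apply: atmost0 => lam /(singleP _ _ un)[_ ji ki]; rewrite ji ki in nN.
Qed.

Lemma atmost_pair A i j : i != j -> atmost (produced_values A [set i; j]%SET) 2.
Proof. by move=> ij; have := atmost_produced A [set i; j]; rewrite cards2 ij. Qed.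

(** A produced value is at least both diagonal entries, whereas two distinct ones would sum to the
    trace. *)
Lemma atmost_pair_nonneg A i j k : uniq [:: i; j; k] -> 0 <= A i j -> 0 <= A j i ->
  atmost (produced_values A [set i; j]%SET) 1.
Proof.
move=> un b0 c0; apply: atmostP => -[|x [|y s]] // us sJ; exfalso.
have xy : x - y != 0 by move: us; rewrite subr_eq0 /= inE negb_or -andbA => /and3P[].
have bounds z : produced_values A [set i; j]%SET z ->
    [/\ A i i <= z, A j j <= z & (z - A i i) * (z - A j j) = A i j * A j i].
  move=> /(pairP _ _ un) [u [v [[u0 v0] e1 e2 _]]].
  have h1 : (z - A i i) * u = A i j * v by lra.
  have h2 : (z - A j j) * v = A j i * u by lra.
  split.
  - by rewrite -subr_ge0 -(pmulr_lge0 _ u0) h1 mulr_ge0 // ltW.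
  - by rewrite -subr_ge0 -(pmulr_lge0 _ v0) h2 mulr_ge0 // ltW.
  - have uv0 : u * v != 0 by rewrite mulf_neq0 ?gt_eqF.
    by apply: (mulIf uv0); rewrite mulrACA h1 h2; ring.
have [x1 x2 ex] := bounds x (sJ x (mem_head _ _)).
have [y1 y2 ey] := bounds y (sJ y ltac:(by rewrite !inE eqxx orbT)).
have sum0 : x + y - A i i - A j j = 0 by apply: (mulfI xy); lra.
by move/eqP: xy; apply; lra.
Qed.

Lemma no_pair_against_row A i j k (un : uniq [:: i; j; k]) :
  A k i < 0 -> A k j < 0 -> atmost (produced_values A [set i; j]%SET) 0.
Proof.
move=> ki kj; apply: atmost0 => lam /(pairP _ _ un) [u [v [[u0 v0] _ _]]].
by rewrite leNgt => /negP; apply; rewrite -(addr0 0) ltrD // nmulr_rlt0.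
Qed.

Lemma atmost_spectrum A i j k m1 m2 m3 m12 m13 m23 m123 : uniq [:: i; j; k] ->
    atmost (produced_values A [set i]%SET) m1 ->
    atmost (produced_values A [set j]%SET) m2 ->
    atmost (produced_values A [set k]%SET) m3 ->
    atmost (produced_values A [set i; j]%SET) m12 ->
    atmost (produced_values A [set i; k]%SET) m13 ->
    atmost (produced_values A [set j; k]%SET) m23 ->
    atmost (produced_values A [set: 'I_3]%SET) m123 ->
  atmost (pareto_spectrum A) (m1 + (m2 + (m3 + (m12 + (m13 + (m23 + m123)))))).
Proof.
move=> un h1 h2 h3 h12 h13 h23 h123.
apply: atmost_sub (atmostU h1 (atmostU h2 (atmostU h3 (atmostU h12 (atmostU h13
  (atmostU h23 h123)))))) => lam /pareto_produced[J hJ].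
have := support3_cases un hJ.1; rewrite !inE.
move=> /orP[|/orP[|/orP[|/orP[|/orP[|/orP[]]]]]] /eqP eJ; rewrite eJ in hJ.
- by left.
- by right; left.
- by do 2 right; left.
- by do 3 right; left.
- by do 4 right; left.
- by do 5 right; left.
- by do 6 right.
Qed.

Lemma perm3 i j k : uniq [:: i; j; k] ->
  [/\ uniq [:: i; k; j], uniq [:: j; i; k], uniq [:: j; k; i],
    uniq [:: k; i; j] & uniq [:: k; j; i]].
Proof.
move=> /distinct3P[ij ik jk].
by split; rewrite /= !inE negb_or ?ij ?ik ?jk ?[j == i]eq_sym ?[k == i]eq_sym
  ?[k == j]eq_sym ?ij ?ik ?jk.
Qed.

(** Without a productive singleton the total is 2 + 2 + 2 + 3. If [{i}] is productive, either a
    nonnegative entry of row [i] costs a pair containing [i] one value, or both are negative and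
    [{j,k}] produces nothing. *)
Lemma atmost9_one_column A i j k : uniq [:: i; j; k] ->
    ~~ ((0 <= A i j) && (0 <= A k j)) -> ~~ ((0 <= A i k) && (0 <= A j k)) ->
  atmost (pareto_spectrum A) 9.
Proof.
move=> un nNj nNk; have [ij ik jk] := distinct3P un.
have [un1 un2 un3 un4 un5] := perm3 un.
have hi := atmost_single A un.
have hj := atmost_single A un2; rewrite (negPf nNj) in hj.
have hk := atmost_single A un4; rewrite (negPf nNk) in hk.
have hij := atmost_pair A ij; have hik := atmost_pair A ik.
have hjk := atmost_pair A jk; have hT := atmost_produced A [set: 'I_3].
rewrite cardsT card_ord in hT.
have [/andP[ji ki]|nNi] := boolP ((0 <= A j i) && (0 <= A k i)); last first.
  rewrite (negPf nNi) in hi.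
  exact: (atmost_spectrum un hi hj hk hij hik hjk hT).
rewrite ji ki in hi.
have [Aij|Aij] := leP 0 (A i j).
  exact: (atmost_spectrum un hi hj hk (atmost_pair_nonneg un Aij ji) hik hjk hT).
have [Aik|Aik] := leP 0 (A i k).
  exact: (atmost_spectrum un hi hj hk hij (atmost_pair_nonneg un1 Aik ki) hjk hT).
apply: atmost_leq (atmost_spectrum un hi hj hk hij hik
  (no_pair_against_row un3 Aij Aik) hT) => //.
Qed.

(** The pair [{i,j}] keeps one value. If the third column is nonnegative too, every pair does and
    the total is 3 + 3 + 3. Otherwise it is 2 + 1 + 2 + 2 + 3, and one of the last three terms must
    fall short. *)
Lemma atmost9_two_columns A i j k : uniq [:: i; j; k] ->
    (0 <= A j i) && (0 <= A k i) -> (0 <= A i j) && (0 <= A k j) ->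
  atmost (pareto_spectrum A) 9.
Proof.
move=> un /andP[ji ki] /andP[Aij kj]; have [ij ik jk] := distinct3P un.
have [un1 un2 un3 un4 un5] := perm3 un.
have hi := atmost_single A un; rewrite ji ki in hi.
have hj := atmost_single A un2; rewrite Aij kj in hj.
have hk := atmost_single A un4.
have hij := atmost_pair_nonneg un Aij ji; have hik := atmost_pair A ik.
have hjk := atmost_pair A jk; have hT := atmost_produced A [set: 'I_3].
rewrite cardsT card_ord in hT.
have [/andP[Aik Ajk]|nNk] := boolP ((0 <= A i k) && (0 <= A j k)).
  rewrite Aik Ajk in hk.
  exact: (atmost_spectrum un hi hj hk hij (atmost_pair_nonneg un1 Aik ki)
    (atmost_pair_nonneg un3 Ajk kj) hT).
rewrite (negPf nNk) in hk.
have [hik'|/atmostPn[sl [ul zl hl]]] := pselect (atmost (produced_values A [set i; k]%SET) 1).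
  exact: (atmost_spectrum un hi hj hk hij hik' hjk hT).
have [hjk'|/atmostPn[sm [um zm hm]]] := pselect (atmost (produced_values A [set j; k]%SET) 1).
  exact: (atmost_spectrum un hi hj hk hij hik hjk' hT).
have [hT'|/atmostPn[sn [uT zn hn]]] := pselect (atmost (produced_values A [set: 'I_3]%SET) 2).
  exact: (atmost_spectrum un hi hj hk hij hik hjk hT').
case: sl ul zl hl => [|l1 [|l2 []]] //= + _ hl; rewrite inE andbT => l12.
case: sm um zm hm => [|m1 [|m2 []]] //= + _ hm; rewrite inE andbT => m12.
case: sn uT zn hn => [|n1 [|n2 [|n3 []]]] // uT _ hn.
move: (uT); rewrite /= !inE negb_or andbT => /andP[/andP[n12 n13] n23].
by case: (no_tenth_value un ki kj l12 m12 n12 n13 n23 hl hm hn).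
Qed.

Lemma atmost_pareto_spectrum3 A : atmost (pareto_spectrum A) 9.
Proof.
have un : uniq [:: idx1; idx2; idx3] by [].
have [un1 un2 un3 un4 un5] := perm3 un.
have [N1|N1] := boolP ((0 <= A idx2 idx1) && (0 <= A idx3 idx1));
have [N2|N2] := boolP ((0 <= A idx1 idx2) && (0 <= A idx3 idx2)).
- exact: atmost9_two_columns un N1 N2.
- have [N3|N3] := boolP ((0 <= A idx1 idx3) && (0 <= A idx2 idx3)).
    by apply: atmost9_two_columns un1 _ _; rewrite // andbC.
  exact: atmost9_one_column un N2 N3.
- have [N3|N3] := boolP ((0 <= A idx1 idx3) && (0 <= A idx2 idx3)).
    by apply: atmost9_two_columns un3 _ _; rewrite // andbC.
  by apply: atmost9_one_column un2 N1 _; rewrite // andbC.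
- by apply: atmost9_one_column un4 _ _; rewrite // andbC.
Qed.

End Capacity3.

(** * Locating the produced values *)

Section Certificates.
Context {R : realType}.
Implicit Types (A : 'M[R]_3) (i j k l : 'I_3) (lam n e x : R) (J : {set 'I_3}).

Definition regular_values A J (s : seq R) : Prop :=
  (forall lam, lam \in s -> regularly_produced A J lam) /\
  (forall lam, produced_values A J lam -> lam \in s).

(** The order is that of the entries of a profile; positions 0 to 6 serve as tags. *)
Definition supports3 : seq {set 'I_3} :=
  [:: [set idx1]; [set idx2]; [set idx3]; [set idx1; idx2]; [set idx1; idx3];
      [set idx2; idx3]; [set: 'I_3]]%SET.

Definition support3 (t : nat) : {set 'I_3} := nth finset.set0 supports3 t.

Lemma support3_inj t t' : (t < 7)%N -> (t' < 7)%N ->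
  (support3 t == support3 t') = (t == t').
Proof.
have u : uniq supports3.
  rewrite /= !inE !negb_or; do ! (apply/andP; split=> //);
  by apply/eqP => /setP e; move: (e idx1) (e idx2) (e idx3); rewrite !inE.
by move=> ht ht'; rewrite /support3 nth_uniq.
Qed.

Lemma support3_onto J : J <> finset.set0 -> exists2 t, (t < 7)%N & J = support3 t.
Proof.
have un : uniq [:: idx1; idx2; idx3] by [].
move=> /(support3_cases un) hJ; exists (index J supports3).
  by rewrite -[7%N]/(size supports3) index_mem.
by rewrite /support3 nth_index.
Qed.

Definition tag_count (s : seq (R * nat)) (t : nat) := count (fun z => z.2 == t) s.

Definition tag_profile s : profile :=
  ((tag_count s 0, tag_count s 1, tag_count s 2),
   (tag_count s 3, tag_count s 4, tag_count s 5), tag_count s 6).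

(** The list holds the spectrum in increasing order, each value tagged with its support. Strict
    order keeps the values of different supports apart, which gives both the count nine and the
    uniqueness of supports. *)
Lemma profile_certificate A (s : seq (R * nat)) :
    sorted <%R (unzip1 s) -> size s = 9%N -> (forall z, z \in s -> z.2 < 7)%N ->
    (forall t, (t < 7)%N ->
       regular_values A (support3 t) [seq z.1 | z <- s & z.2 == t]) ->
  [/\ full_capacity A,
      has_card (pareto_spectrum A) 9 /\
      (forall lam, pareto_spectrum A lam -> regular_pareto_eigenvalue A lam),
      unique_producing_supports A & has_intrinsic_profile A (tag_profile s)].
Proof.
move=> sort_s size_s tag_s val_s.
have us : uniq (unzip1 s) by apply: sorted_uniq sort_s; [exact: lt_trans|exact: ltxx].
have mem_valuesP t lam : reflect ((lam, t) \in s)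
    (lam \in [seq z.1 | z <- s & z.2 == t]).
  apply: (iffP mapP) => [[[m t']]|h]; last by exists (lam, t); rewrite ?mem_filter ?eqxx.
  by rewrite mem_filter => /andP[/eqP /= -> h] ->.
have regP lam t : (lam, t) \in s -> regularly_produced A (support3 t) lam.
  by move=> h; apply: (val_s t (tag_s _ h)).1; apply/mem_valuesP.
have prodP lam J : produced_values A J lam ->
    exists t, J = support3 t /\ (lam, t) \in s.
  move=> h; have [t t7 eJ] := support3_onto h.1; exists t; split=> //.
  by apply/mem_valuesP; apply: (val_s t t7).2; rewrite -eJ.
have regular_produced lam J : regularly_produced A J lam -> produced_values A J lam.
  by move=> [J0 _ [u pu _]]; split=> //; exists u.
(* First components are distinct, so both pairs stand at the same position of [s]. *)
have tag_inj lam t t' : (lam, t) \in s -> (lam, t') \in s -> t = t'.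
  move=> h h'; have := us.
  have i_lt := h; have i'_lt := h'; rewrite -!index_mem in i_lt i'_lt.
  move=> /(uniqP 0); rewrite /unzip1 => /(_ (index (lam, t) s) (index (lam, t') s)).
  rewrite !inE size_map => /(_ i_lt i'_lt).
  rewrite !(nth_map (0, 0%N)) ?nth_index // => /(_ erefl) ii.
  by have := nth_index (0, 0%N) h; rewrite ii nth_index // => -[].
have specP lam : pareto_spectrum A lam <-> exists t, (lam, t) \in s.
  split=> [/pareto_produced[J /prodP[t [_ h]]]|[t h]]; first by exists t.
  exact: produced_pareto (regular_produced _ _ (regP _ _ h)).
have specE : pareto_spectrum A = [set` unzip1 s].
  apply/seteqP; split=> lam /=.
    by move=> /specP[t h]; apply/mapP; exists (lam, t).
  by move=> /mapP[[m t] h ->]; apply/specP; exists t.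
have card9 : has_card (pareto_spectrum A) 9.
  by rewrite specE -size_s -(size_map fst); exact: has_card_seq.
have uniq_supp : unique_producing_supports A.
  move=> lam /specP[t h]; exists (support3 t); split.
    exact/regular_produced/regP.
  by move=> J /prodP[t' [-> h']]; rewrite (tag_inj _ _ _ h h').
split=> //.
(* [A] itself attains nine, so the general upper bound makes nine the capacity. *)
- exists 9%N => //; split; first by exists A.
  by move=> B; apply/atmost_card_le/atmost_pareto_spectrum3.
- split=> // lam; move=> /[dup] sl /specP[t h]; split=> //.
  by exists (support3 t); apply: regP.
split=> //.
(* [tau] looks up the tag at the position of [lam]; off the spectrum it takes the default tag 0. *)
pose tau lam := support3 (nth 0%N (unzip2 s) (index lam (unzip1 s))).
have tauE lam t : (lam, t) \in s -> tau lam = support3 t.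
  move=> h; rewrite /tau; congr support3.
  have hi : (index lam (unzip1 s) < size s)%N.
    by rewrite -(size_map fst) index_mem; apply/mapP; exists (lam, t).
  apply: (tag_inj lam) => //; rewrite (nth_map (0, 0%N)) //.
  rewrite -[X in (X, _)](@nth_index _ 0 _ (unzip1 s)); last first.
    by apply/mapP; exists (lam, t).
  by rewrite (nth_map (0, 0%N)) // -surjective_pairing mem_nth.
have asg_tau : assigned_support_map A tau.
  by move=> lam /specP[t h]; rewrite (tauE _ _ h); apply/regular_produced/regP.
exists tau; split=> //.
  move=> tau' h' lam sl; have [J [_ uJ]] := uniq_supp lam sl.
  by rewrite -(uJ _ (h' _ sl)) -(uJ _ (asg_tau _ sl)).
have card_tag t : (t < 7)%N ->
    has_card (assigned_values A tau (support3 t)) (tag_count s t).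
  move=> t7; rewrite /tag_count -size_filter -(size_map fst).
  suff -> : assigned_values A tau (support3 t) =
      [set` [seq z.1 | z <- s & z.2 == t]].
    apply: has_card_seq; apply: subseq_uniq us.
    exact/map_subseq/filter_subseq.
  apply/seteqP; split=> lam /=.
    move=> [/specP[t' h]]; rewrite (tauE _ _ h) => /eqP.
    rewrite support3_inj ?(tag_s _ h) // => /eqP e.
    by apply/mem_valuesP; rewrite -e.
  by move=> /mem_valuesP h; split; [apply/specP; exists t|exact: tauE].
split; last exact: (card_tag 6%N isT).
- by split; [exact: (card_tag 0%N isT)|exact: (card_tag 1%N isT)
    |exact: (card_tag 2%N isT)].
- by split; [exact: (card_tag 3%N isT)|exact: (card_tag 4%N isT)
    |exact: (card_tag 5%N isT)].
Qed.

End Certificates.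

(** * Sign windows for singletons and pairs *)

Section Windows.
Context {R : realType}.
Implicit Types (A : 'M[R]_3) (i j k l : 'I_3) (lam n e x : R) (J : {set 'I_3}).

Lemma regular_single A i j k : uniq [:: i; j; k] -> 0 < A j i -> 0 < A k i ->
  regular_values A [set i]%SET [:: A i i].
Proof.
move=> un ji ki; have [ij ik jk] := distinct3P un.
have eig : eigen_on A [set i]%SET (A i i) (fun=> 1).
  by move=> m; rewrite !inE big_set1 => /eqP->.
split=> lam; last by move=> /(singleP _ _ un)[-> _ _]; rewrite mem_seq1.
rewrite mem_seq1 => /eqP->; apply: (regularly_produced_on _ _ eig).
- by apply/eqP/set0Pn; exists i; rewrite inE.
- apply: (simple_eigenvalue_on (s := [:: A i i])); rewrite ?cards1 ?mem_seq1 //.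
  move=> m; rewrite mem_seq1 => /eqP->; exists (fun=> 1); split=> //.
  by exists i; rewrite ?inE ?oner_neq0.
- by move=> m _.
- move=> m; rewrite big_set1 mulr1 !inE => mi.
  by have := distinct3_mem m un; rewrite !inE (negPf mi) /= => /orP[] /eqP->.
Qed.

Lemma no_single A i j k : uniq [:: i; j; k] -> A j i < 0 \/ A k i < 0 ->
  regular_values A [set i]%SET [::].
Proof.
move=> un neg; split=> // lam /(singleP _ _ un)[_ ji ki].
by case: neg; rewrite ltNge ?ji ?ki.
Qed.

Lemma affine_gt0 (f : R -> R) lo hi x (a b : R) : (forall y, f y = a + b * y) ->
  lo < x < hi -> 0 < f lo -> 0 < f hi -> 0 < f x.
Proof.
move=> fE /andP[lox xhi]; rewrite !fE => flo fhi.
have [b0|/ltW b0] := leP 0 b; [apply: lt_le_trans flo _|apply: lt_le_trans fhi _].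
  by rewrite lerD2l ler_wpM2l // ltW.
by rewrite lerD2l ler_wnM2l // ltW.
Qed.

(** A strict sign change, hence an open condition on the coefficients of [f]. *)
Definition crosses (f : R -> R) n : Prop := f n * f (n + 1) < 0.

Lemma crosses_root (p : {poly R}) n : crosses (horner p) n ->
  exists2 x, n < x < n + 1 & p.[x] = 0.
Proof.
rewrite /crosses => pn.
have nn : n <= n + 1 by rewrite lerDl.
have [x /andP[nx xn] rx] : exists2 x, n <= x <= n + 1 & root p x.
  have [p0|p0] := leP p.[n] 0.
    by apply: poly_ivt => //; rewrite p0; nra.
  have [|x xn] := @poly_ivt _ (- p) n (n + 1) nn.
    by rewrite !hornerN oppr_le0 oppr_ge0 (ltW p0); nra.
  by rewrite rootN; exists x.
have px : p.[x] = 0 by apply/eqP.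
(* The root lies strictly inside, since a root at an end would make the product of the end values
   zero. *)
exists x => //; rewrite !lt_neqAle nx xn !andbT.
apply/andP; split; apply: contraTneq pn => e.
  by rewrite e px mul0r ltxx.
by rewrite -e px mulr0 ltxx.
Qed.

(* [(A i j, x - A i i)] spans the eigenline of the principal submatrix on {i, j}.
   Multiplied by [A i j], it has a positive first entry; its second one is then
   [pair_entry], and [pair_slack] is the component [k] of its image. *)
Definition pair_poly A i j x := (x - A i i) * (x - A j j) - A i j * A j i.
Definition pair_entry A i j x := (x - A i i) * A i j.
Definition pair_slack A i j k x := (A k i * A i j + A k j * (x - A i i)) * A i j.

Definition pair_ok A i j k n : Prop :=
  [/\ crosses (pair_poly A i j) n,
      0 < pair_entry A i j n /\ 0 < pair_entry A i j (n + 1)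
    & 0 < pair_slack A i j k n /\ 0 < pair_slack A i j k (n + 1)].

(** An eigenvalue that is not produced is located as well: once both eigenvalues are known, each is
    simple and no other value can be produced. *)
Definition pair_bad A i j k n : Prop :=
  crosses (pair_poly A i j) n /\
  (0 < - pair_entry A i j n /\ 0 < - pair_entry A i j (n + 1) \/
   0 < - pair_slack A i j k n /\ 0 < - pair_slack A i j k (n + 1)).

Lemma pair_polyE A i j :
  exists p : {poly R}, pair_poly A i j = horner p.
Proof.
exists (('X - (A i i)%:P) * ('X - (A j j)%:P) - (A i j * A j i)%:P).
by apply/funext => x; rewrite !hornerE.
Qed.

Lemma pair_root A i j n : crosses (pair_poly A i j) n ->
  exists2 x, n < x < n + 1 & pair_poly A i j x = 0.
Proof. by have [p ->] := pair_polyE A i j; exact: crosses_root. Qed.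

Definition pair_vec A i j x (m : 'I_3) : R :=
  if m == i then A i j * A i j else pair_entry A i j x.

Lemma pair_eigen A i j x : i != j -> pair_poly A i j x = 0 ->
  eigen_on A [set i; j]%SET x (pair_vec A i j x).
Proof.
move=> ij; rewrite /pair_poly => e m; rewrite sum2 // !inE /pair_vec eqxx.
rewrite [j == i]eq_sym (negPf ij) /pair_entry => /orP[]/eqP->.
  by rewrite eqxx; ring.
by rewrite [j == i]eq_sym (negPf ij); have := congr1 ( *%R (A i j)) e; lra.
Qed.

Lemma pair_eigenvalue A i j x : i != j -> A i j != 0 -> pair_poly A i j x = 0 ->
  eigenvalue_on A [set i; j]%SET x.
Proof.
move=> ij Aij /(pair_eigen ij) e; exists (pair_vec A i j x); split=> //.
by exists i; rewrite ?inE ?eqxx // /pair_vec eqxx mulf_neq0.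
Qed.

Lemma pair_regular A i j k x : uniq [:: i; j; k] ->
    simple_eigenvalue (principal_submx A [set i; j]%SET) x ->
    pair_poly A i j x = 0 -> 0 < pair_entry A i j x -> 0 < pair_slack A i j k x ->
  regularly_produced A [set i; j]%SET x.
Proof.
move=> un sx px ex kx; have [ij ik jk] := distinct3P un.
apply: regularly_produced_on (pair_eigen ij px) _ _ => //.
- by apply/eqP/set0Pn; exists i; rewrite !inE eqxx.
- move=> m _; rewrite /pair_vec; case: ifP => // _.
  rewrite -expr2 lt_def sqr_ge0 sqrf_eq0 andbT.
  by apply: contraTneq ex => z; rewrite /pair_entry z mulr0 ltxx.
- move=> m; rewrite sum2 // /pair_vec eqxx [j == i]eq_sym (negPf ij) !inE.
  have := distinct3_mem m un; rewrite !inE => /or3P[] /eqP->; rewrite ?eqxx ?orbT // => _.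
  by move: kx; rewrite /pair_slack /pair_entry; lra.
Qed.

(** By the first row, multiplying the two quantities by [u > 0] gives the square of [A i j] times
    [v], respectively times the outside component. *)
Lemma produced_pair_signs A i j k x : uniq [:: i; j; k] ->
    produced_values A [set i; j]%SET x ->
  0 <= pair_entry A i j x /\ 0 <= pair_slack A i j k x.
Proof.
move=> un /(pairP _ _ un) [u [v [[u0 v0] e1 e2 e3]]].
have h : (x - A i i) * u = A i j * v by lra.
split; rewrite -(pmulr_lge0 _ u0).
  rewrite (_ : _ * u = A i j * A i j * v); last by rewrite /pair_entry mulrAC h; ring.
  by rewrite mulr_ge0 ?(ltW v0) // -expr2 sqr_ge0.
rewrite (_ : _ * u = A i j * A i j * (A k i * u + A k j * v)).
  by rewrite mulr_ge0 // -expr2 sqr_ge0.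
have := congr1 ( *%R (A k j * A i j)) h; rewrite /pair_slack; lra.
Qed.

Lemma pair_ok_at A i j k n x : pair_ok A i j k n -> n < x < n + 1 ->
  0 < pair_entry A i j x /\ 0 < pair_slack A i j k x.
Proof.
move=> [_ [e1 e2] [s1 s2]] nx; split.
  apply: (@affine_gt0 _ n (n + 1) _ (- A i i * A i j) (A i j)) => // y.
  by rewrite /pair_entry; ring.
apply: (@affine_gt0 _ n (n + 1) _ ((A k i * A i j - A k j * A i i) * A i j)
  (A k j * A i j)) => // y.
by rewrite /pair_slack; ring.
Qed.

Lemma pair_bad_at A i j k n x : pair_bad A i j k n -> n < x < n + 1 ->
  pair_entry A i j x < 0 \/ pair_slack A i j k x < 0.
Proof.
move=> [_ [[e1 e2]|[e1 e2]]] nx; [left|right]; rewrite -oppr_gt0.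
  apply: (@affine_gt0 (fun x => - pair_entry A i j x) n (n + 1) _
    (A i i * A i j) (- A i j)) => // y.
  by rewrite /pair_entry; ring.
apply: (@affine_gt0 (fun x => - pair_slack A i j k x) n (n + 1) _
  (- (A k i * A i j - A k j * A i i) * A i j) (- (A k j * A i j))) => // y.
by rewrite /pair_slack; ring.
Qed.

Lemma pair_entry_neq0 A i j k n : pair_ok A i j k n -> A i j != 0.
Proof.
case=> _ [h _] _.
by apply: contraTneq h => z; rewrite /pair_entry z mulr0 ltxx.
Qed.

Lemma two_pair_roots A i j x y : i != j -> A i j != 0 -> x < y ->
    pair_poly A i j x = 0 -> pair_poly A i j y = 0 ->
  (forall z, z \in [:: x; y] ->
     simple_eigenvalue (principal_submx A [set i; j]%SET) z) /\
  (forall z, produced_values A [set i; j]%SET z -> z \in [:: x; y]).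
Proof.
move=> ij Aij xy px py.
have us : uniq [:: x; y] by rewrite /= inE lt_eqF.
have sz : size [:: x; y] = #|[set i; j]%SET| by rewrite cards2 ij.
have es z : z \in [:: x; y] -> eigenvalue_on A [set i; j]%SET z.
  by rewrite !inE => /orP[] /eqP->; apply: pair_eigenvalue.
split=> z; last exact: produced_mem.
exact: simple_eigenvalue_on.
Qed.

Lemma regular_two_values A i j k n1 n2 : uniq [:: i; j; k] -> n1 + 1 <= n2 ->
    pair_ok A i j k n1 -> pair_ok A i j k n2 ->
  exists x y, [/\ n1 < x < n1 + 1, n2 < y < n2 + 1 &
    regular_values A [set i; j]%SET [:: x; y]].
Proof.
move=> un n12 ok1 ok2; have [ij _ _] := distinct3P un.
have [x nx px] : exists2 x, n1 < x < n1 + 1 & pair_poly A i j x = 0.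
  by apply: pair_root; case: ok1.
have [y ny py] : exists2 x, n2 < x < n2 + 1 & pair_poly A i j x = 0.
  by apply: pair_root; case: ok2.
have xy : x < y by lra.
have [sim mem] := two_pair_roots ij (pair_entry_neq0 ok1) xy px py.
exists x, y; split=> //; split=> // z zs; move: (zs); rewrite !inE.
case/orP=> /eqP ez; move: zs; rewrite ez => /sim sz.
  by have [] := pair_ok_at ok1 nx; exact: pair_regular.
by have [] := pair_ok_at ok2 ny; exact: pair_regular.
Qed.

Lemma regular_one_value A i j k n1 n2 : uniq [:: i; j; k] -> n1 + 1 <= n2 ->
    pair_bad A i j k n1 -> pair_ok A i j k n2 ->
  exists2 y, n2 < y < n2 + 1 & regular_values A [set i; j]%SET [:: y].
Proof.
move=> un n12 bad1 ok2; have [ij _ _] := distinct3P un.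
have [x nx px] : exists2 x, n1 < x < n1 + 1 & pair_poly A i j x = 0.
  by apply: pair_root; case: bad1.
have [y ny py] : exists2 x, n2 < x < n2 + 1 & pair_poly A i j x = 0.
  by apply: pair_root; case: ok2.
have xy : x < y by lra.
have [sim mem] := two_pair_roots ij (pair_entry_neq0 ok2) xy px py.
exists y => //; split=> z.
  rewrite mem_seq1 => /eqP->; have [] := pair_ok_at ok2 ny.
  by apply: pair_regular => //; apply: sim; rewrite !inE eqxx orbT.
move=> /[dup] /mem; rewrite !inE => /orP[/eqP->|//] /(produced_pair_signs un)[e s].
by case: (pair_bad_at bad1 nx); rewrite ltNge ?e ?s.
Qed.

End Windows.

(** * Sign windows for the full support *)

Section TripleWindows.
Context {R : realType}.
Implicit Types (A : 'M[R]_3) (i j k l : 'I_3) (lam n e x : R) (J : {set 'I_3}).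

(* The cross product of the rows [i] and [j] of [A - x] spans the kernel of
   [A - x]; [triple_fst] and [triple_snd] are its entries [i] and [j], which are
   affine in [x].  The sign of the third entry is read off the row [k]. *)
Definition triple_poly A i j k x :=
  (x - A i i) * (x - A j j) * (x - A k k) - A i j * A j k * A k i
  - A i k * A j i * A k j - (x - A j j) * (A i k * A k i)
  - (x - A i i) * (A j k * A k j) - (x - A k k) * (A i j * A j i).
Definition triple_fst A i j k x := A i j * A j k + A i k * (x - A j j).
Definition triple_snd A i j k x := A i k * A j i + (x - A i i) * A j k.

(** The factor [e], equal to [1] or [-1] in the applications, orients the cross product; the bound
    on [A k k] makes [x - A k k] positive throughout the window. *)
Definition triple_ok A i j k e n : Prop :=
  [/\ crosses (triple_poly A i j k) n, 0 < n - A k k,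
      0 < e * triple_fst A i j k n /\ 0 < e * triple_fst A i j k (n + 1)
    & 0 < e * triple_snd A i j k n /\ 0 < e * triple_snd A i j k (n + 1)].

Definition triple_bad A i j k e n : Prop :=
  [/\ crosses (triple_poly A i j k) n,
      0 < e * triple_fst A i j k n /\ 0 < e * triple_fst A i j k (n + 1)
    & 0 < - e * triple_snd A i j k n /\ 0 < - e * triple_snd A i j k (n + 1)].

Lemma triple_root A i j k n : crosses (triple_poly A i j k) n ->
  exists2 x, n < x < n + 1 & triple_poly A i j k x = 0.
Proof.
have -> : triple_poly A i j k = horner (
  ('X - (A i i)%:P) * ('X - (A j j)%:P) * ('X - (A k k)%:P)
  - (A i j * A j k * A k i)%:P - (A i k * A j i * A k j)%:P
  - ('X - (A j j)%:P) * (A i k * A k i)%:P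
  - ('X - (A i i)%:P) * (A j k * A k j)%:P
  - ('X - (A k k)%:P) * (A i j * A j i)%:P).
  by apply/funext => x; rewrite !hornerE /= /triple_poly; ring.
exact: crosses_root.
Qed.

Definition triple_vec A i j k e x (m : 'I_3) : R :=
  e * (if m == i then triple_fst A i j k x
       else if m == j then triple_snd A i j k x else pair_poly A i j x).

Lemma triple_eigen A i j k e x : uniq [:: i; j; k] ->
  triple_poly A i j k x = 0 -> eigen_on A [set: 'I_3]%SET x (triple_vec A i j k e x).
Proof.
move=> un px m _; have [ij ik jk] := distinct3P un.
have -> : \sum_(l in [set: 'I_3]%SET) A m l * triple_vec A i j k e x l =
    \sum_l A m l * triple_vec A i j k e x l by apply: eq_bigl => l; rewrite inE.
rewrite (sum3 _ un) /triple_vec !eqxx [j == i]eq_sym [k == i]eq_sym [k == j]eq_sym.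
rewrite (negPf ij) (negPf ik) (negPf jk).
have := distinct3_mem m un; rewrite !inE => /or3P[] /eqP->.
- by rewrite eqxx /triple_fst /triple_snd /pair_poly; ring.
- rewrite [j == i]eq_sym (negPf ij) eqxx.
  by rewrite /triple_fst /triple_snd /pair_poly; ring.
- rewrite [k == i]eq_sym [k == j]eq_sym (negPf ik) (negPf jk).
  (* Rows [i] and [j] hold identically; in row [k] the two sides differ by [- e] times the
     characteristic polynomial. *)
  apply/eqP; rewrite -subr_eq0 -[X in _ == X](mulr0 (- e)) -px.
  by rewrite /triple_fst /triple_snd /pair_poly /triple_poly; apply/eqP; ring.
Qed.

Lemma triple_eigenvalue A i j k e x : uniq [:: i; j; k] ->
    triple_poly A i j k x = 0 -> 0 < e * triple_fst A i j k x ->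
  eigenvalue_on A [set: 'I_3]%SET x.
Proof.
move=> un px ex; exists (triple_vec A i j k e x); split; last exact: triple_eigen.
by exists i; rewrite ?inE // /triple_vec eqxx gt_eqF.
Qed.

Lemma triple_regular A i j k e x : uniq [:: i; j; k] ->
    0 < A k i -> 0 < A k j ->
    simple_eigenvalue (principal_submx A [set: 'I_3]%SET) x ->
    triple_poly A i j k x = 0 -> 0 < x - A k k ->
    0 < e * triple_fst A i j k x -> 0 < e * triple_snd A i j k x ->
  regularly_produced A [set: 'I_3]%SET x.
Proof.
move=> un ki kj sx px kx fx gx; apply: regularly_produced_on (triple_eigen e un px) _ _ => //.
- by apply/eqP/set0Pn; exists i; rewrite !inE.
(* Row [k] equates [x - A k k] times the third entry with [A k i] and [A k j] times the first two,
   where everything else is positive. *)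
- have third : 0 < e * pair_poly A i j x.
    rewrite -(pmulr_lgt0 _ kx).
    rewrite (_ : e * _ * _ = e * triple_fst A i j k x * A k i + e * triple_snd A i j k x * A k j).
      by rewrite addr_gt0 // mulr_gt0.
    apply/eqP; rewrite -subr_eq0 -[X in _ == X](mulr0 e) -px.
    by rewrite /triple_fst /triple_snd /pair_poly /triple_poly; apply/eqP; ring.
  by move=> m _; rewrite /triple_vec; do 2?[case: ifP => // _].
- by move=> m; rewrite inE.
Qed.

(** Eliminating [w] from rows [i] and [j] makes the two quantities proportional to [u] and [v],
    which are positive. *)
Lemma produced_triple_sign A i j k x : uniq [:: i; j; k] ->
    produced_values A [set: 'I_3]%SET x ->
  0 <= triple_fst A i j k x * triple_snd A i j k x.
Proof.
move=> un /(tripleP _ _ un) [u [v [w [[u0 v0 w0] e1 e2 _]]]].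
have h : triple_fst A i j k x * v = triple_snd A i j k x * u.
  rewrite /triple_fst /triple_snd.
  have h1 := congr1 ( *%R (A j k)) e1; have h2 := congr1 ( *%R (A i k)) e2; lra.
rewrite -(pmulr_lge0 _ v0) mulrAC h mulrAC -expr2.
by rewrite mulr_ge0 ?sqr_ge0 ?ltW.
Qed.

Lemma triple_fst_gt0 A i j k e n x : n < x < n + 1 ->
    0 < e * triple_fst A i j k n -> 0 < e * triple_fst A i j k (n + 1) ->
  0 < e * triple_fst A i j k x.
Proof.
apply: (@affine_gt0 _ (fun x => e * triple_fst A i j k x) _ _ _
  (e * (A i j * A j k - A i k * A j j)) (e * A i k)) => y.
by rewrite /triple_fst; ring.
Qed.

Lemma triple_snd_gt0 A i j k e n x : n < x < n + 1 ->
    0 < e * triple_snd A i j k n -> 0 < e * triple_snd A i j k (n + 1) ->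
  0 < e * triple_snd A i j k x.
Proof.
apply: (@affine_gt0 _ (fun x => e * triple_snd A i j k x) _ _ _
  (e * (A i k * A j i - A i i * A j k)) (e * A j k)) => y.
by rewrite /triple_snd; ring.
Qed.

Lemma three_roots A (x y z : R) : x < y -> y < z ->
    (forall u, u \in [:: x; y; z] -> eigenvalue_on A [set: 'I_3]%SET u) ->
  (forall u, u \in [:: x; y; z] ->
     simple_eigenvalue (principal_submx A [set: 'I_3]%SET) u) /\
  (forall u, produced_values A [set: 'I_3]%SET u -> u \in [:: x; y; z]).
Proof.
move=> xy yz es.
have us : uniq [:: x; y; z].
  by rewrite /= !inE !lt_eqF // (lt_trans xy yz).
have sz : size [:: x; y; z] = #|[set: 'I_3]%SET| by rewrite cardsT card_ord.
split=> u; last exact: produced_mem.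
exact: simple_eigenvalue_on.
Qed.

Lemma triple_ok_at A i j k e n : uniq [:: i; j; k] -> 0 < A k i -> 0 < A k j ->
    triple_ok A i j k e n ->
  exists2 x, n < x < n + 1 & eigenvalue_on A [set: 'I_3]%SET x /\
    (simple_eigenvalue (principal_submx A [set: 'I_3]%SET) x ->
     regularly_produced A [set: 'I_3]%SET x).
Proof.
move=> un ki kj [/triple_root[x nx px] kn [f1 f2] [g1 g2]]; exists x => //.
have fx := triple_fst_gt0 nx f1 f2; have gx := triple_snd_gt0 nx g1 g2.
split; first exact: triple_eigenvalue fx.
by move=> sx; apply: triple_regular un ki kj sx px _ fx gx; lra.
Qed.

Lemma triple_bad_at A i j k e n : uniq [:: i; j; k] -> triple_bad A i j k e n ->
  exists2 x, n < x < n + 1 & eigenvalue_on A [set: 'I_3]%SET x /\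
    ~ produced_values A [set: 'I_3]%SET x.
Proof.
move=> un [/triple_root[x nx px] [f1 f2] [g1 g2]]; exists x => //.
have fx := triple_fst_gt0 nx f1 f2; have gx := triple_snd_gt0 nx g1 g2.
split; first exact: triple_eigenvalue fx.
move=> /(produced_triple_sign un); rewrite leNgt => /negP; apply.
rewrite mulNr oppr_gt0 in gx.
have : (e * e) * (triple_fst A i j k x * triple_snd A i j k x) < 0.
  by rewrite mulrACA pmulr_rlt0.
by apply: contraTT; rewrite -!leNgt => h; rewrite mulr_ge0 // -expr2 sqr_ge0.
Qed.

Lemma regular_three_values A i j k e1 e2 e3 n1 n2 n3 : uniq [:: i; j; k] ->
    0 < A k i -> 0 < A k j -> n1 + 1 <= n2 -> n2 + 1 <= n3 ->
    triple_ok A i j k e1 n1 -> triple_ok A i j k e2 n2 -> triple_ok A i j k e3 n3 ->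
  exists x y z, [/\ n1 < x < n1 + 1, n2 < y < n2 + 1, n3 < z < n3 + 1 &
    regular_values A [set: 'I_3]%SET [:: x; y; z]].
Proof.
move=> un ki kj n12 n23.
move=> /(triple_ok_at un ki kj)[x nx [ex rx]].
move=> /(triple_ok_at un ki kj)[y ny [ey ry]].
move=> /(triple_ok_at un ki kj)[z nz [ez rz]].
have [||u|sim mem] := @three_roots A x y z; [lra|lra| |].
  by rewrite !inE => /or3P[] /eqP->.
exists x, y, z; split=> //; split=> // u us; move: (us) (sim u us).
by rewrite !inE => /or3P[] /eqP->.
Qed.

Lemma regular_last_two_values A i j k e1 e2 e3 n1 n2 n3 : uniq [:: i; j; k] ->
    0 < A k i -> 0 < A k j -> n1 + 1 <= n2 -> n2 + 1 <= n3 ->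
    triple_bad A i j k e1 n1 -> triple_ok A i j k e2 n2 -> triple_ok A i j k e3 n3 ->
  exists y z, [/\ n2 < y < n2 + 1, n3 < z < n3 + 1 &
    regular_values A [set: 'I_3]%SET [:: y; z]].
Proof.
move=> un ki kj n12 n23.
move=> /(triple_bad_at un)[x nx [ex rx]].
move=> /(triple_ok_at un ki kj)[y ny [ey ry]].
move=> /(triple_ok_at un ki kj)[z nz [ez rz]].
have [||u|sim mem] := @three_roots A x y z; [lra|lra| |].
  by rewrite !inE => /or3P[] /eqP->.
exists y, z; split=> //; split=> u.
  move=> us; have := sim u; rewrite inE us orbT => /(_ isT).
  by move: us; rewrite !inE => /orP[] /eqP->.
by move=> /[dup] /mem; rewrite inE => /orP[/eqP->|].
Qed.

End TripleWindows.

(** * The three open sets *)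

Section Openness.
Context {R : realType}.
Local Notation M := 'M[R]_3.
Implicit Types (f g : M -> R) (P Q S T : M -> Prop) (i j k : 'I_3).

(** The pointwise form lets the tactic [continuity] follow the syntax of a polynomial in the
    entries. *)
Lemma continuous_add f g : continuous f -> continuous g ->
  continuous (fun A => f A + g A).
Proof. by move=> cf cg A; exact: (continuousD (cf A) (cg A)). Qed.

Lemma continuous_mul f g : continuous f -> continuous g ->
  continuous (fun A => f A * g A).
Proof. by move=> cf cg A; exact: (continuousM (cf A) (cg A)). Qed.

Lemma continuous_opp f : continuous f -> continuous (fun A => - f A).
Proof. by move=> cf A; exact: (continuousN (cf A)). Qed.

Lemma open_gt0 f : continuous f -> open [set A | 0 < f A].
Proof.
move=> cf; have := @open_comp _ _ f [set x : R | 0 < x].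
by apply; [move=> A _; exact: cf|exact: open_gt].
Qed.

Lemma open_and P Q : open [set A | P A] -> open [set A | Q A] ->
  open [set A | P A /\ Q A].
Proof. exact: openI. Qed.

Lemma open_or P Q : open [set A | P A] -> open [set A | Q A] ->
  open [set A | P A \/ Q A].
Proof. exact: openU. Qed.

Lemma open_and3 P Q S : open [set A | P A] -> open [set A | Q A] ->
  open [set A | S A] -> open [set A | [/\ P A, Q A & S A]].
Proof.
move=> oP oQ oS; have -> : [set A | [/\ P A, Q A & S A]] = [set A | P A /\ Q A /\ S A].
  by apply/seteqP; split=> [A [? ? ?]|A [? [? ?]]].
by do 2?apply: open_and.
Qed.

Lemma open_and4 P Q S T : open [set A | P A] -> open [set A | Q A] ->
  open [set A | S A] -> open [set A | T A] -> open [set A | [/\ P A, Q A, S A & T A]].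
Proof.
move=> oP oQ oS oT.
have -> : [set A | [/\ P A, Q A, S A & T A]] = [set A | P A /\ [/\ Q A, S A & T A]].
  by apply/seteqP; split=> [A [? ? ? ?]|A [? [? ? ?]]].
by apply: open_and => //; apply: open_and3.
Qed.

Lemma continuous_entry i j : continuous (fun A : M => A i j).
Proof. exact: coord_continuous. Qed.

Lemma continuous_const (c : R) : continuous (fun _ : M => c).
Proof. exact: cst_continuous. Qed.

Ltac continuity := cbv beta; lazymatch goal with
  | |- continuous (fun _ => ?c) => exact (@continuous_const c)
  | |- continuous (fun A => @?f A + @?g A) =>
      apply (@continuous_add f g); continuity
  | |- continuous (fun A => @?f A * @?g A) =>
      apply (@continuous_mul f g); continuity
  | |- continuous (fun A => - @?f A) => apply (@continuous_opp f); continuity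
  | |- continuous (fun A => fun_of_matrix A ?i ?j) => exact (@continuous_entry i j)
  end.

Lemma open_crosses (f : M -> R -> R) n : (forall x, continuous (f^~ x)) ->
  open [set A | crosses (f A) n].
Proof.
move=> cf; rewrite (_ : [set A | _] = [set A | 0 < - (f A n * f A (n + 1))]).
  by apply: open_gt0; apply: continuous_opp; apply: continuous_mul.
by apply/funext => A /=; rewrite /crosses oppr_gt0.
Qed.

Lemma open_pair_ok i j k n : open [set A : M | pair_ok A i j k n].
Proof.
rewrite /pair_ok /pair_entry /pair_slack; apply: open_and3; first last.
- by apply: open_and; apply: open_gt0; continuity.
- by apply: open_and; apply: open_gt0; continuity.
- by apply: open_crosses => x; rewrite /pair_poly; continuity.
Qed.

Lemma open_pair_bad i j k n : open [set A : M | pair_bad A i j k n].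
Proof.
rewrite /pair_bad /pair_entry /pair_slack; apply: open_and.
  by apply: open_crosses => x; rewrite /pair_poly; continuity.
by apply: open_or; apply: open_and; apply: open_gt0; continuity.
Qed.

Lemma open_triple_ok i j k e n : open [set A : M | triple_ok A i j k e n].
Proof.
rewrite /triple_ok /triple_fst /triple_snd; apply: open_and4.
- by apply: open_crosses => x; rewrite /triple_poly; continuity.
- by apply: open_gt0; continuity.
- by apply: open_and; apply: open_gt0; continuity.
- by apply: open_and; apply: open_gt0; continuity.
Qed.

Lemma open_triple_bad i j k e n : open [set A : M | triple_bad A i j k e n].
Proof.
rewrite /triple_bad /triple_fst /triple_snd; apply: open_and3.
- by apply: open_crosses => x; rewrite /triple_poly; continuity.
- by apply: open_and; apply: open_gt0; continuity.
- by apply: open_and; apply: open_gt0; continuity.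
Qed.

Lemma open_entry_gt0 i j : open [set A : M | 0 < A i j].
Proof. by apply: open_gt0; continuity. Qed.

Lemma open_entry_lt0 i j : open [set A : M | A i j < 0].
Proof.
rewrite (_ : [set A | _] = [set A : M | 0 < - A i j]); first by apply: open_gt0; continuity.
by apply/funext => A /=; rewrite oppr_gt0.
Qed.

Lemma open_entry_itv i j (a b : R) : open [set A : M | a < A i j < b].
Proof.
rewrite (_ : [set A | _] = [set A : M | 0 < A i j - a /\ 0 < b - A i j]).
  by apply: open_and; apply: open_gt0; continuity.
by apply/funext => A /=; rewrite !subr_gt0; apply/propext; split=> [/andP[]|[? ?]] //; apply/andP.
Qed.

End Openness.

(** * Explicit windows and matrices for the three profiles *)

Section Profiles.
Context {R : realType}.
Local Notation M := 'M[R]_3.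

Let un123 : uniq [:: idx1; idx2; idx3] := isT.
Let un132 : uniq [:: idx1; idx3; idx2] := isT.
Let un231 : uniq [:: idx2; idx3; idx1] := isT.
Let un213 : uniq [:: idx2; idx1; idx3] := isT.
Let un312 : uniq [:: idx3; idx1; idx2] := isT.

(** Only column 1 is positive off the diagonal, so only [{1}] among the singletons produces. The
    full support is read off row 2, whose off-diagonal entries are positive; in the other two
    systems this is row 3. *)
Definition conditions_1 (A : M) : Prop :=
  [/\ [/\ 0 < A idx2 idx1, 0 < A idx3 idx1, 0 < A idx2 idx3 & 61 < A idx1 idx1 < 63],
      A idx3 idx2 < 0 /\ A idx1 idx3 < 0,
      [/\ pair_bad A idx1 idx2 idx3 (-10) /\ pair_ok A idx1 idx2 idx3 65,
          pair_ok A idx1 idx3 idx2 22 /\ pair_ok A idx1 idx3 idx2 39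
        & pair_ok A idx2 idx3 idx1 (-5) /\ pair_ok A idx2 idx3 idx1 (-2)]
    & [/\ triple_ok A idx1 idx3 idx2 1 1, triple_ok A idx1 idx3 idx2 1 4
        & triple_ok A idx1 idx3 idx2 1 49]].

Definition conditions_2 (A : M) : Prop :=
  [/\ [/\ 0 < A idx2 idx1 /\ 0 < A idx3 idx1, 0 < A idx1 idx2 /\ 0 < A idx3 idx2,
        23 < A idx1 idx1 < 25 & 17 < A idx2 idx2 < 19],
      A idx1 idx3 < 0,
      [/\ pair_bad A idx1 idx2 idx3 4 /\ pair_ok A idx1 idx2 idx3 37,
          pair_ok A idx1 idx3 idx2 8 /\ pair_ok A idx1 idx3 idx2 15
        & pair_bad A idx2 idx3 idx1 1 /\ pair_ok A idx2 idx3 idx1 16]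
    & [/\ triple_ok A idx1 idx2 idx3 1 3, triple_ok A idx1 idx2 idx3 (-1) 5
        & triple_ok A idx1 idx2 idx3 (-1) 32]].

(** The entry signs are those of [conditions_2], but [{2,3}] keeps both values and the full support
    loses its smallest one. *)
Definition conditions_3 (A : M) : Prop :=
  [/\ [/\ 0 < A idx2 idx1 /\ 0 < A idx3 idx1, 0 < A idx1 idx2 /\ 0 < A idx3 idx2,
        13 < A idx1 idx1 < 15 & 16 < A idx2 idx2 < 18],
      A idx1 idx3 < 0,
      [/\ pair_bad A idx1 idx2 idx3 0 /\ pair_ok A idx1 idx2 idx3 30,
          pair_ok A idx1 idx3 idx2 1 /\ pair_ok A idx1 idx3 idx2 12
        & pair_ok A idx2 idx3 idx1 5 /\ pair_ok A idx2 idx3 idx1 11]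
    & [/\ triple_bad A idx1 idx2 idx3 1 (-1), triple_ok A idx1 idx2 idx3 (-1) 4
        & triple_ok A idx1 idx2 idx3 (-1) 26]].

Ltac open_conditions := repeat first
  [ apply: open_entry_gt0 | apply: open_entry_lt0 | apply: open_entry_itv
  | apply: open_pair_ok | apply: open_pair_bad | apply: open_triple_ok
  | apply: open_triple_bad | apply: open_and4 | apply: open_and3 | apply: open_and ].

Lemma open_conditions_1 : open [set A | conditions_1 A].
Proof. by rewrite /conditions_1; open_conditions. Qed.

Lemma open_conditions_2 : open [set A | conditions_2 A].
Proof. by rewrite /conditions_2; open_conditions. Qed.

Lemma open_conditions_3 : open [set A | conditions_3 A].
Proof. by rewrite /conditions_3; open_conditions. Qed.

Definition matrix_of_rows (rows : seq (seq R)) : M :=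
  \matrix_(i, j) nth 0 (nth [::] rows i) j.

Ltac check_inequalities := lazymatch goal with
  | |- and3 _ _ _ => split; check_inequalities
  | |- and4 _ _ _ _ => split; check_inequalities
  | |- _ /\ _ => split; check_inequalities
  | |- _ \/ _ => first [left; solve [check_inequalities]
                       |right; solve [check_inequalities]]
  | |- _ => first [lra | by apply/andP; split; lra]
  end.

Ltac check_conditions :=
  rewrite /pair_bad /pair_ok /triple_ok /triple_bad /crosses /pair_entry
    /pair_slack /pair_poly /triple_fst /triple_snd /triple_poly !mxE /=;
  check_inequalities.

(** For instance [{2,3}] has the polynomial [x^2 + 6x + 6], whose roots -4.73... and -1.27... lie in
    the windows starting at -5 and -2. *)
Lemma conditions_1_inhabited : conditions_1
  (matrix_of_rows [:: [:: 62; 54; -19]; [:: 4; -6; 2]; [:: 47; -3; 0]]).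
Proof. by rewrite /conditions_1; check_conditions. Qed.

Lemma conditions_2_inhabited : conditions_2
  (matrix_of_rows [:: [:: 24; 20; -22]; [:: 13; 18; -15]; [:: 6; 2; 0]]).
Proof. by rewrite /conditions_2; check_conditions. Qed.

Lemma conditions_3_inhabited : conditions_3
  (matrix_of_rows [:: [:: 14; 15; -10]; [:: 14; 17; -9]; [:: 2; 7; 0]]).
Proof. by rewrite /conditions_3; check_conditions. Qed.

Definition profile_properties (A : M) (p : profile) : Prop :=
  [/\ full_capacity A,
      has_card (pareto_spectrum A) 9 /\
      (forall lam, pareto_spectrum A lam -> regular_pareto_eigenvalue A lam),
      unique_producing_supports A & has_intrinsic_profile A p].

Lemma conditions_1_profile A :
  conditions_1 A -> profile_properties A ((1, 0, 0), (1, 2, 2), 3)%N.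
Proof.
move=> [[a21 a31 a23 a11] [a32 a13] [[b12 c12] [b13 c13] [b23 c23]] [t1 t2 t3]].
have v1 := regular_single un123 a21 a31.
have v2 := no_single un213 (or_intror a32).
have v3 := no_single un312 (or_introl a13).
have [|x12 x12i v12] := regular_one_value un123 _ b12 c12; first by lra.
have [|x13 [y13 [x13i y13i v13]]] := regular_two_values un132 _ b13 c13.
  by lra.
have [|x23 [y23 [x23i y23i v23]]] := regular_two_values un231 _ b23 c23.
  by lra.
have [||x [y [z [xi yi zi v123]]]] :=
  regular_three_values un132 a21 a23 _ _ t1 t2 t3; [by lra|by lra|].
(* The nine values in increasing order with the tags of their supports; the windows of the produced
   values are disjoint and fix this order. *)
pose s := [:: (x23, 5); (y23, 5); (x, 6); (y, 6); (x13, 4); (y13, 4); (z, 6);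
  (A idx1 idx1, 0); (x12, 3)]%N.
have s_sorted : sorted <%R (unzip1 s) by rewrite /=; do ! (apply/andP; split); lra.
apply: (profile_certificate s_sorted) => // [|t].
  by apply/allP.
by case: t => [|[|[|[|[|[|[|//]]]]]]] _; [exact: v1|exact: v2|exact: v3|exact: v12
  |exact: v13|exact: v23|exact: v123].
Qed.

Lemma conditions_2_profile A :
  conditions_2 A -> profile_properties A ((1, 1, 0), (1, 2, 1), 3)%N.
Proof.
move=> [[[a21 a31] [a12 a32] a11 a22] a13 [[b12 c12] [b13 c13] [b23 c23]] [t1 t2 t3]].
have v1 := regular_single un123 a21 a31.
have v2 := regular_single un213 a12 a32.
have v3 := no_single un312 (or_introl a13).
have [|x12 x12i v12] := regular_one_value un123 _ b12 c12; first by lra.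
have [|x13 [y13 [x13i y13i v13]]] := regular_two_values un132 _ b13 c13.
  by lra.
have [|x23 x23i v23] := regular_one_value un231 _ b23 c23; first by lra.
have [||x [y [z [xi yi zi v123]]]] :=
  regular_three_values un123 a31 a32 _ _ t1 t2 t3; [by lra|by lra|].
pose s := [:: (x, 6); (y, 6); (x13, 4); (y13, 4); (x23, 5); (A idx2 idx2, 1);
  (A idx1 idx1, 0); (z, 6); (x12, 3)]%N.
have s_sorted : sorted <%R (unzip1 s) by rewrite /=; do ! (apply/andP; split); lra.
apply: (profile_certificate s_sorted) => // [|t].
  by apply/allP.
by case: t => [|[|[|[|[|[|[|//]]]]]]] _; [exact: v1|exact: v2|exact: v3|exact: v12
  |exact: v13|exact: v23|exact: v123].
Qed.

Lemma conditions_3_profile A :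
  conditions_3 A -> profile_properties A ((1, 1, 0), (1, 2, 2), 2)%N.
Proof.
move=> [[[a21 a31] [a12 a32] a11 a22] a13 [[b12 c12] [b13 c13] [b23 c23]] [t1 t2 t3]].
have v1 := regular_single un123 a21 a31.
have v2 := regular_single un213 a12 a32.
have v3 := no_single un312 (or_introl a13).
have [|x12 x12i v12] := regular_one_value un123 _ b12 c12; first by lra.
have [|x13 [y13 [x13i y13i v13]]] := regular_two_values un132 _ b13 c13.
  by lra.
have [|x23 [y23 [x23i y23i v23]]] := regular_two_values un231 _ b23 c23.
  by lra.
have [||y [z [yi zi v123]]] :=
  regular_last_two_values un123 a31 a32 _ _ t1 t2 t3; [by lra|by lra|].
pose s := [:: (x13, 4); (y, 6); (x23, 5); (y23, 5); (y13, 4); (A idx1 idx1, 0);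
  (A idx2 idx2, 1); (z, 6); (x12, 3)]%N.
have s_sorted : sorted <%R (unzip1 s) by rewrite /=; do ! (apply/andP; split); lra.
apply: (profile_certificate s_sorted) => // [|t].
  by apply/allP.
by case: t => [|[|[|[|[|[|[|//]]]]]]] _; [exact: v1|exact: v2|exact: v3|exact: v12
  |exact: v13|exact: v23|exact: v123].
Qed.

End Profiles.

Theorem theorem7p5 (R : realType) :
  exists O : profile -> set 'M[R]_3,
    (forall p : profile, listed_profile p ->
       [/\ O p !=set0, open (O p)
         & forall A : 'M[R]_3, O p A ->
             [/\ full_capacity A,
                 has_card (pareto_spectrum A) 9 /\
                 (forall lam : R, pareto_spectrum A lam ->
                    regular_pareto_eigenvalue A lam),
                 unique_producing_supports A
               & has_intrinsic_profile A p]]) /\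
    (forall p q : profile, listed_profile p -> listed_profile q -> p <> q ->
       O p `&` O q = set0).
Proof.
pose O (p : profile) : set 'M[R]_3 :=
  if p == ((1, 0, 0), (1, 2, 2), 3)%N then [set A | conditions_1 A] else
  if p == ((1, 1, 0), (1, 2, 1), 3)%N then [set A | conditions_2 A] else
  [set A | conditions_3 A].
exists O; split=> [p [] ->|].
- split; last exact: conditions_1_profile; last exact: open_conditions_1.
  by eexists; exact: conditions_1_inhabited.
- split; last exact: conditions_2_profile; last exact: open_conditions_2.
  by eexists; exact: conditions_2_inhabited.
- split; last exact: conditions_3_profile; last exact: open_conditions_3.
  by eexists; exact: conditions_3_inhabited.
(* The entry (3,2) is negative in the first set and positive in the other two, which are separated
   by the intervals for the entry (1,1). *)
have disj12 A : conditions_1 A -> ~ conditions_2 A.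
  by move=> [_ [a32 _] _ _] [[_ [_]]]; rewrite ltNge ltW.
have disj13 A : conditions_1 A -> ~ conditions_3 A.
  by move=> [_ [a32 _] _ _] [[_ [_]]]; rewrite ltNge ltW.
have disj23 A : conditions_2 A -> ~ conditions_3 A.
  by move=> [[_ _ a _] _ _ _] [[_ _ b _] _ _ _]; lra.
move=> p q [] -> [] -> pq; apply/seteqP; split=> // A [] //.
- by move=> /disj12 h /h.
- by move=> /disj13 h /h.
- by move=> h /disj12/(_ h).
- by move=> /disj23 h /h.
- by move=> h /disj13/(_ h).
- by move=> h /disj23/(_ h).
Qed.
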